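(* Let $p\in(2,3)$, let $q\ge p$ be such that $\frac{2}{p}+\frac1q>1$, and let $r>1$ be such that $\frac1r=\frac1p+\frac1q$. Suppose that $S\in D([0,T];\mathbb{R}^d)$ satisfies Property (RIE) with respect to $p$ and a sequence of partitions $\mathcal{P}^n=\{0=t^n_0<t^n_1<\cdots<t^n_{N_n}=T\}$, $n\in\mathbb{N}$. Let $(F,F')\in\mathcal{V}^{q,r}_S$ and $(G,G')\in\mathcal{V}^{q,r}_S$ be controlled paths with respect to $S$, and assume that $J_F\subseteq\bigcup_{n\in\mathbb{N}}\mathcal{P}^n$, where $J_F:=\{t\in(0,T]: F_{t-,t}\neq0\}$ is the set of jump times of $F$. Then the rough integral of $(F,F')$ against $(G,G')$ relative to the rough path $\mathbf{S}=(S,S,A)$ is given by $$\int_0^t F_u\,\mathrm{d}G_u=\lim_{n\to\infty}\sum_{k=0}^{N_n-1}F_{t^n_k}\,G_{t^n_k\wedge t,\,t^n_{k+1}\wedge t},$$ where the convergence is uniform in $t\in[0,T]$.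
   Context: Fix $T>0$ and $d\in\mathbb{N}$. $D([0,T];E)$ is the space of càdlàg functions $[0,T]\to E$, and $\Delta_{[0,T]}:=\{(s,t)\in[0,T]^2:s\le t\}$. For a path $A$ write $A_{s,t}:=A_t-A_s$ and $A_{t-,t}:=A_t-A_{t-}$; for a two-parameter function $A$ on $\Delta_{[0,T]}$, $A_{s,t}$ is its value at $(s,t)$. A partition of $[s,t]$ is a finite set $\{s=t_0<\dots<t_N=t\}$, $[u,v]\in\mathcal{P}$ means that $u<v$ are consecutive points of $\mathcal{P}$, and $|\mathcal{P}|$ is the mesh size. $(a\otimes b)^{ij}=a^ib^j$. $p$-variation ($p\ge1$): $\|A\|_{p,[s,t]}:=\big(\sup_{\mathcal{P}}\sum_{[u,v]\in\mathcal{P}}|A_{u,v}|^p\big)^{1/p}$, the supremum being over partitions of $[s,t]$ (for paths or two-parameter functions). $D^p$ is the space of càdlàg paths on $[0,T]$ of finite $p$-variation. $D^p_2$ is the space of functions on $\Delta_{[0,T]}$ of finite $p$-variation which are càdlàg in each of the two variables separately. A control function is a map $w:\Delta_{[0,T]}\to[0,\infty)$ with $w(s,u)+w(u,t)\le w(s,t)$ for $s\le u\le t$. Property (RIE): Let $p\in(2,3)$ and let $\mathcal{P}^n=\{0=t^n_0<\cdots<t^n_{N_n}=T\}$, $n\in\mathbb{N}$, be nested partitions ($\mathcal{P}^n\subset\mathcal{P}^{n+1}$) of $[0,T]$ with $|\mathcal{P}^n|\to0$. For $S\in D([0,T];\mathbb{R}^d)$ set $S^n_t=S_T\mathbf{1}_{\{T\}}(t)+\sum_{k=0}^{N_n-1}S_{t^n_k}\mathbf{1}_{[t^n_k,t^n_{k+1})}(t)$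 and $\int_0^tS^n_u\otimes\mathrm{d}S_u:=\sum_{k=0}^{N_n-1}S_{t^n_k}\otimes S_{t^n_k\wedge t,t^n_{k+1}\wedge t}$, with $\int_s^t:=\int_0^t-\int_0^s$. $S$ satisfies (RIE) with respect to $p$ and $(\mathcal{P}^n)$ if: (a) $S^n\to S$ uniformly; (b) $\int_0^\cdot S^n_u\otimes\mathrm{d}S_u$ converges uniformly on $[0,T]$ to a limit, denoted $\int_0^\cdot S_u\otimes\mathrm{d}S_u$; (c) there is a control function $w$ such that (with $\frac00:=0$) $$\sup_{(s,t)\in\Delta_{[0,T]}}\frac{|S_{s,t}|^p}{w(s,t)}+\sup_{n}\sup_{0\le k<\ell\le N_n}\frac{\big|\int_{t^n_k}^{t^n_\ell}S^n_u\otimes\mathrm{d}S_u-S_{t^n_k}\otimes S_{t^n_k,t^n_\ell}\big|^{p/2}}{w(t^n_k,t^n_\ell)}\le1.$$ Associated rough path: under (RIE), $\mathbf{S}=(S,S,A)$ with $A_{s,t}:=\int_0^tS_u\otimes\mathrm{d}S_u-\int_0^sS_u\otimes\mathrm{d}S_u-S_s\otimes S_{s,t}$; one has $S\in D^p$, $A\in D^{p/2}_2$ and $A_{s,t}=A_{s,u}+A_{u,t}+S_{s,u}\otimes S_{u,t}$. Controlled paths: $(F,F')\in\mathcal{V}^{q,r}_S$ means $F\in D^p([0,T];\mathbb{R}^d)$, $F'\in D^q([0,T];\mathcal{L}(\mathbb{R}^d;\mathbb{R}^d))$ and $R^F\in D^r_2(\Delta_{[0,T]};\mathbb{R}^d)$,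 where $R^F_{s,t}:=F_{s,t}-F'_sS_{s,t}$. Rough integral relative to $\mathbf{S}$: $\int_0^tF_u\,\mathrm{d}G_u:=\lim_{|\mathcal{P}|\to0}\sum_{[u,v]\in\mathcal{P}}\big(F_uG_{u,v}+F'_uG'_uA_{u,v}\big)$, the limit being along partitions $\mathcal{P}$ of $[0,t]$ with mesh tending to zero (it is known to exist along every such sequence). Here the product $F_uG_{u,v}$ is usually the Euclidean inner product $\sum_iF^i_uG^i_{u,v}$, in which case $F'_uG'_uA_{u,v}=\sum_{i,j,k}(F'_u)^{ij}(G'_u)^{ik}A^{jk}_{u,v}$ (any other fixed bilinear product of the two vectors is allowed, with the compensator modified accordingly). *)

(* Defs.v *)
From HB Require Import structures.
From mathcomp Require Import all_boot all_order all_algebra.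
From mathcomp Require Import all_classical all_reals all_analysis.

Set Implicit Arguments.
Unset Strict Implicit.
Unset Printing Implicit Defensive.

Import Order.TTheory GRing.Theory Num.Theory.
Import numFieldNormedType.Exports.

Local Open Scope classical_set_scope.
Local Open Scope ring_scope.

(* Paths on [0, T] are total functions on R and two-parameter functions on
   {0 <= s <= t <= T} are total functions on R * R; no definition below looks
   at their values outside these domains.  Vectors of R^d are column vectors. *)

(* Frobenius norm; it is the Euclidean norm on column vectors, whereas `| | on
   matrices is the maximum norm.  Both induce the same topology. *)
Definition enorm {R : realType} {m n : nat} (x : 'M[R]_(m, n)) : R :=
  Num.sqrt (\sum_(i < m) \sum_(j < n) x i j ^+ 2).

Definition tensor {R : realType} {d : nat} (x y : 'cV[R]_d) : 'M[R]_d :=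
  x *m y^T.

Lemma tensorE {R : realType} {d : nat} (x y : 'cV[R]_d) i j :
  tensor x y i j = x i ord0 * y j ord0.
Proof. by rewrite /tensor mxE big_ord1 !mxE. Qed.

Definition incr {R : realType} {V : zmodType} (f : R -> V) (s t : R) : V :=
  f t - f s.

Definition cadlag {R : realType} {E : topologicalType} (a b : R) (f : R -> E)
    : Prop :=
  (forall t, a <= t < b -> f x @[x --> t^'+] --> f t) /\
  (forall t, a < t <= b -> exists l : E, f x @[x --> t^'-] --> l).

(* In [itv_partition a b s] the list [s] omits the left endpoint: the points of
   the partition are a :: s, and its consecutive pairs are zip (a :: s) s. *)
Definition partition_sum {R : realType} {V : zmodType} (f : R -> R -> V)
    (a : R) (s : seq R) : V :=
  \sum_(uv <- zip (a :: s) s) f uv.1 uv.2.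

Definition mesh {R : realType} (a : R) (s : seq R) : R :=
  \big[Order.max/0]_(uv <- zip (a :: s) s) (uv.2 - uv.1).

Definition mesh_to0 {R : realType} (a b : R) : set_system (seq R) :=
  filter_from [set e : R | 0 < e]
    (fun e => [set s | itv_partition a b s /\ mesh a s < e]).

Definition pvar {R : realType} {m n : nat} (p a b : R)
    (A : R -> R -> 'M[R]_(m, n)) : \bar R :=
  ((ereal_sup [set (partition_sum (fun u v => enorm (A u v) `^ p)%R a s)%:E
              | s in itv_partition a b]) `^ p^-1)%E.

Definition Dp {R : realType} {m n : nat} (T p : R) (f : R -> 'M[R]_(m, n))
    : Prop :=
  cadlag 0 T f /\ (pvar p 0 T (incr f) < +oo)%E.

Definition Dp2 {R : realType} {m n : nat} (T p : R)
    (A : R -> R -> 'M[R]_(m, n)) : Prop :=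
  [/\ forall s, 0 <= s <= T -> cadlag s T (A s),
      forall t, 0 <= t <= T -> cadlag 0 t (A^~ t) &
      (pvar p 0 T A < +oo)%E].

Definition control {R : realType} (T : R) (w : R -> R -> R) : Prop :=
  (forall s t, 0 <= s -> s <= t -> t <= T -> 0 <= w s t) /\
  (forall s u t, 0 <= s -> s <= u -> u <= t -> t <= T ->
     w s u + w u t <= w s t).

Definition nested_partitions {R : realType} (T : R) (P : nat -> seq R) : Prop :=
  [/\ forall n, itv_partition 0 T (P n),
      forall n, {subset 0 :: P n <= 0 :: P n.+1} &
      mesh 0 (P n) @[n --> \oo] --> (0 : R)].

(* The point t^n_k, 0 <= k <= N_n, where N_n = size (P n). *)
Definition ppt {R : realType} (P : nat -> seq R) (n k : nat) : R :=
  nth 0 (0 :: P n) k.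

Definition step_path {R : realType} {d : nat} (T : R) (P : nat -> seq R)
    (S : R -> 'cV[R]_d) (n : nat) (t : R) : 'cV[R]_d :=
  \1_[set T] t *: S T +
  \sum_(k < size (P n))
     \1_[set` `[ppt P n k, ppt P n k.+1[ ] t *: S (ppt P n k).

Definition left_point_sum {R : realType} {U V : zmodType} {W : zmodType}
    (B : U -> V -> W) (P : nat -> seq R) (F : R -> U) (G : R -> V)
    (n : nat) (t : R) : W :=
  \sum_(k < size (P n))
     B (F (ppt P n k))
       (incr G (Num.min (ppt P n k) t) (Num.min (ppt P n k.+1) t)).

Definition step_integral {R : realType} {d : nat} (P : nat -> seq R)
    (S : R -> 'cV[R]_d) : nat -> R -> 'M[R]_d :=
  left_point_sum tensor P S S.

(* The inverse of extended reals gives x / 0 = +oo for x > 0, and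
   0 / 0 = 0 * +oo = 0. *)
Definition equot {R : realType} (x y : R) : \bar R := (x%:E / y%:E)%E.

Definition simplex {R : realType} (T : R) : set (R * R) :=
  [set st | 0 <= st.1 /\ st.1 <= st.2 /\ st.2 <= T].

Definition RIE_bound {R : realType} {d : nat} (T p : R) (P : nat -> seq R)
    (S : R -> 'cV[R]_d) (w : R -> R -> R) : Prop :=
  let area_n n k l :=
    incr (step_integral P S n) (ppt P n k) (ppt P n l)
    - tensor (S (ppt P n k)) (incr S (ppt P n k) (ppt P n l)) in
  (ereal_sup [set equot (enorm (incr S st.1 st.2) `^ p) (w st.1 st.2)
             | st in simplex T] +
   ereal_sup [set ereal_sup [set equot (enorm (area_n n kl.1 kl.2) `^ (p / 2))
                                       (w (ppt P n kl.1) (ppt P n kl.2))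
                            | kl in [set kl | (kl.1 < kl.2 <= size (P n))%N]]
             | n in [set: nat]]
   <= 1)%E.

Definition RIE {R : realType} {d : nat} (T p : R) (P : nat -> seq R)
    (S : R -> 'cV[R]_d) : Prop :=
  [/\ 2 < p < 3,
      nested_partitions T P,
      {uniform [set` `[0, T]], step_path T P S n @[n --> \oo] --> S},
      exists I : R -> 'M[R]_d,
        {uniform [set` `[0, T]], step_integral P S n @[n --> \oo] --> I} &
      exists w : R -> R -> R, control T w /\ RIE_bound T p P S w].

(* Under [RIE] the uniform limit of the integrals exists and coincides on
   [0, T] with this pointwise one. *)
Definition RIE_integral {R : realType} {d : nat} (P : nat -> seq R)
    (S : R -> 'cV[R]_d) (t : R) : 'M[R]_d :=
  lim (step_integral P S n t @[n --> \oo]).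

Definition area {R : realType} {d : nat} (P : nat -> seq R)
    (S : R -> 'cV[R]_d) (s t : R) : 'M[R]_d :=
  RIE_integral P S t - RIE_integral P S s - tensor (S s) (incr S s t).

Definition remainder {R : realType} {d : nat} (S : R -> 'cV[R]_d)
    (F : R -> 'cV[R]_d) (F' : R -> 'M[R]_d) (s t : R) : 'cV[R]_d :=
  incr F s t - F' s *m incr S s t.

Definition controlled {R : realType} {d : nat} (T p q r : R)
    (S : R -> 'cV[R]_d) (F : R -> 'cV[R]_d) (F' : R -> 'M[R]_d) : Prop :=
  [/\ Dp T p F, Dp T q F' & Dp2 T r (remainder S F F')].

(* The value at A of the linear map sending a tensor x (x) y to
   B (F' x) (G' y); see [compensator_inner] for the inner product. *)
Definition compensator {R : realType} {d : nat} {V : lmodType R}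
    (B : 'cV[R]_d -> 'cV[R]_d -> V) (F' G' A : 'M[R]_d) : V :=
  \sum_(j < d) \sum_(k < d) A j k *: B (col j F') (col k G').

Lemma compensator_tensor {R : realType} {d : nat} {V : lmodType R}
    (B : {bilinear 'cV[R]_d -> 'cV[R]_d -> V}) (F' G' : 'M[R]_d)
    (x y : 'cV[R]_d) :
  compensator B F' G' (tensor x y) = B (F' *m x) (G' *m y).
Proof.
have colE (M : 'M[R]_d) (z : 'cV[R]_d) : M *m z = \sum_j z j ord0 *: col j M.
  apply/colP => i; rewrite mxE summxE; apply: eq_bigr => j _.
  by rewrite !mxE mulrC.
rewrite !colE linear_sumlz; apply: eq_bigr => j _.
rewrite linear_sumr; apply: eq_bigr => k _.
by rewrite tensorE linearZl_LR linearZr_LR /= scalerA.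
Qed.

Definition inner {R : realType} {d : nat} (x y : 'cV[R]_d) : R^o :=
  \sum_(i < d) x i ord0 * y i ord0.

Fact inner_is_bilinear {R : realType} {d : nat} :
  bilinear_for (GRing.Scale.Law.clone _ _ *:%R _)
    (GRing.Scale.Law.clone _ _ *:%R _) (@inner R d).
Proof.
split=> [y a x z|x a y z]; rewrite /inner /GRing.scale /= mulr_sumr -big_split;
  apply: eq_bigr => i _; rewrite !mxE; first by rewrite mulrDl mulrA.
by rewrite mulrDr mulrCA.
Qed.

HB.instance Definition _ (R : realType) (d : nat) :=
  bilinear_isBilinear.Build R 'cV[R]_d 'cV[R]_d R^o _ _ (@inner R d)
    inner_is_bilinear.

Lemma compensator_inner {R : realType} {d : nat} (F' G' A : 'M[R]_d) :
  compensator inner F' G' A =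
  \sum_(i < d) \sum_(j < d) \sum_(k < d) F' i j * G' i k * A j k.
Proof.
rewrite /compensator [RHS]exchange_big; apply: eq_bigr => j _ /=.
rewrite [RHS]exchange_big; apply: eq_bigr => k _ /=.
rewrite /inner /GRing.scale /= mulr_sumr; apply: eq_bigr => i _.
by rewrite !mxE; exact: mulrC.
Qed.

Definition compensated_sum {R : realType} {d : nat} {V : lmodType R}
    (B : 'cV[R]_d -> 'cV[R]_d -> V) (A : R -> R -> 'M[R]_d)
    (F : R -> 'cV[R]_d) (F' : R -> 'M[R]_d)
    (G : R -> 'cV[R]_d) (G' : R -> 'M[R]_d) : seq R -> V :=
  partition_sum
    (fun u v => B (F u) (incr G u v) + compensator B (F' u) (G' u) (A u v)) 0.

Definition rough_integral {R : realType} {d : nat} {V : normedModType R}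
    (B : 'cV[R]_d -> 'cV[R]_d -> V) (A : R -> R -> 'M[R]_d)
    (F : R -> 'cV[R]_d) (F' : R -> 'M[R]_d)
    (G : R -> 'cV[R]_d) (G' : R -> 'M[R]_d) (t : R) : V :=
  lim (compensated_sum B A F F' G G' s @[s --> mesh_to0 0 t]).

Definition jump_times {R : realType} {d : nat} (T : R) (F : R -> 'cV[R]_d)
    : set R :=
  [set t | 0 < t <= T /\ F t - lim (F x @[x --> t^'-]) != 0].

(* Main.v *)
(* Expanding B in coordinates reduces everything to real-valued germs
   X(s,t) = f_s g_{s,t} + sum_{a,b} f'^a_s g'^b_s A^{ab}_{s,t}.  Their defect
   X(s,t) - X(s,u) - X(u,t) is a finite sum of products Y(s,u) Z(u,t) with total
   exponent 2/p + 1/q > 1.  A short interval [s,t] contains at most one large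
   jump, which lies in (s,u] or in (u,t], so one of the two factors is small;
   interpolating this with the control bound gives a defect of at most
   kappa * w(s,t)^theta, theta > 1, with kappa -> 0 as the mesh tends to 0.  The
   sewing estimate then makes the compensated sums Cauchy in the mesh, uniformly
   in the end point t, although the controls are not continuous.

   Along the given partitions, the compensator sum_k H_{t_k} A_{t_k, t_{k+1}}
   tends to 0 uniformly: the sums U^n of A itself telescope to the difference
   between the limit of the integrals of S^n and the n-th one, so they are
   uniformly small, and by (RIE) they have uniformly bounded p/2-variation along
   the partition; since H = f' g' has finite q-variation, the sums of H against
   U^n vanish by the same interpolation and sewing estimate. *)

Require Import Defs.
From HB Require Import structures.
From mathcomp Require Import all_boot all_order all_algebra.
From mathcomp Require Import ring lra.
From mathcomp Require Import all_classical all_reals all_analysis.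

Import Order.TTheory GRing.Theory Num.Theory.
Import numFieldNormedType.Exports.

Local Open Scope classical_set_scope.
Local Open Scope ring_scope.

(** * Partition sums and the sewing estimate *)

(** A control with atoms does not become small on short intervals, so bounding the sum of [w^theta]
    by the largest [w^(theta-1)] times [w 0 T] gives boundedness and no convergence. All smallness
    must sit in the factor [kappa]; hence every two-parameter function carries two separate
    properties, a size bound ([holder]) and a jump structure ([small_osc]). With total exponent
    [eta > 1], the sewing exponent is [(1 + eta) / 2]: half of the surplus keeps it above 1, the
    other half pays for [kappa]. A second obstacle is that (RIE) bounds areas only between points of
    one partition, while the sewing of the germ needs the variation of [A] over arbitrary points.
    Nestedness and a limit give the bound for [A] between partition points; rounding every point up
    to the next partition point, where right-continuity applies, gives the rest. Uniformity in the
    end point [t] comes from cutting the partitions off at [t]. This repeats points, so the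
    estimates are made for weakly increasing lists. *)

Lemma partition_sum_nil {R : realType} {V : zmodType} (f : R -> R -> V) a :
  partition_sum f a [::] = 0.
Proof. by rewrite /partition_sum big_nil. Qed.

Lemma partition_sum_cons {R : realType} {V : zmodType} (f : R -> R -> V) a b s :
  partition_sum f a (b :: s) = f a b + partition_sum f b s.
Proof. by rewrite /partition_sum /= big_cons. Qed.

Lemma partition_sum_cat {R : realType} {V : zmodType} (f : R -> R -> V) a s1 s2 :
  partition_sum f a (s1 ++ s2) =
  partition_sum f a s1 + partition_sum f (last a s1) s2.
Proof.
elim: s1 a => [|b s1 IH] a /=; first by rewrite partition_sum_nil add0r.
by rewrite !partition_sum_cons IH addrA.
Qed.

Lemma partition_sum_telescope {R : realType} {V : zmodType} (f : R -> V) a s :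
  partition_sum (incr f) a s = f (last a s) - f a.
Proof.
elim: s a => [|b s IH] a /=; first by rewrite partition_sum_nil subrr.
by rewrite partition_sum_cons IH /incr addrC subrKA.
Qed.

Lemma mem_last_path {R : realType} (a : R) s :
  path <=%R a s -> forall x, x \in a :: s -> x <= last a s.
Proof.
elim: s a => [|b s IH] a /=; first by move=> _ x; rewrite inE => /eqP->.
case/andP=> ab bs x; rewrite inE => /orP[/eqP->|]; last exact: IH.
by apply: (le_trans ab); apply: IH => //; rewrite mem_head.
Qed.

Lemma mem_head_path {R : realType} (a : R) s :
  path <=%R a s -> forall x, x \in a :: s -> a <= x.
Proof.
move=> /(order_path_min (@le_trans _ _)) /allP as_ x.
by rewrite inE => /orP[/eqP-> //|/as_].
Qed.

Section Sewing.
Context {R : realType}.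
Implicit Types (X w : R -> R -> R) (D : set R) (s : seq R).

(** The prefix is lengthened while its control is at most half of the total. At the first point [u]
    that breaks this, superadditivity leaves less than half after [u]; if none does, [u] is the last
    point, where the control vanishes. *)
Lemma half_split D w (a : R) s : s != [::] -> path <=%R a s ->
  (forall x, x \in a :: s -> D x) ->
  (forall x y, D x -> D y -> x <= y -> 0 <= w x y) ->
  (forall x y z, D x -> D y -> D z -> x <= y -> y <= z ->
     w x y + w y z <= w x z) ->
  exists s1 u s2, [/\ s = s1 ++ u :: s2,
    w a (last a s1) <= w a (last a s) / 2 &
    w u (last a s) <= w a (last a s) / 2].
Proof.
move=> s0 as_ sD w0 wD; set b := last a s.
have wxx x : D x -> w x x <= 0.
  by move=> Dx; have := wD x x x Dx Dx Dx (lexx _) (lexx _); lra.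
have Db : D b by apply: sD; exact: mem_last.
have Da : D a by apply: sD; exact: mem_head.
have ab : a <= b by apply: (mem_last_path _ _ as_); exact: mem_head.
have wab := w0 a b Da Db ab.
have H s2 s1 : s = s1 ++ s2 -> s2 != [::] ->
    w a (last a s1) <= w a b / 2 ->
    exists s1 u s2, [/\ s = s1 ++ u :: s2,
      w a (last a s1) <= w a b / 2 & w u b <= w a b / 2].
  elim: s2 s1 => [//|u s2 IH] s1 sE _ ws1.
  have us : u \in a :: s by rewrite sE inE mem_cat mem_head !orbT.
  have [ww|ww] := lerP (w a u) (w a b / 2); last first.
    exists s1, u, s2; split => //.
    have := wD a u b Da (sD _ us) Db (mem_head_path _ _ as_ _ us)
      (mem_last_path _ _ as_ _ us).
    lra.
  have [s20|s20] := eqVneq s2 [::]; last first.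
    by apply: (IH (rcons s1 u)) => //; rewrite ?cat_rcons ?last_rcons.
  exists s1, u, s2; split => //.
  have -> : u = b by rewrite /b sE s20 last_cat.
  by apply: (le_trans (wxx _ Db)); lra.
apply: (H s [::]) => //=.
by apply: (le_trans (wxx _ Da)); lra.
Qed.

(* With [c = 2 / (1 - 2^(1-theta))], so that [2 + 2 c / 2^theta = c], cutting
   out an interval on both sides of which the control is at most halved
   reproduces the bound. *)
Definition sewing_const (theta : R) : R := 2 / (1 - 2 `^ (1 - theta)).

Lemma sewing_const_gt0 theta : 1 < theta -> 0 < sewing_const theta.
Proof.
move=> t1; rewrite divr_gt0// subr_gt0 /powR pnatr_eq0 /= -[ltRHS]expR0 ltr_expR.
by rewrite nmulr_rlt0 ?subr_lt0// ln_gt0// ltr1n.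
Qed.

Lemma sewing_const_fix theta : 1 < theta ->
  2 + 2 * (sewing_const theta * 2 `^ (- theta)) = sewing_const theta.
Proof.
move=> t1; have := sewing_const_gt0 _ t1; rewrite /sewing_const.
have -> : 2 `^ (1 - theta) = 2 * 2 `^ (- theta) :> R.
  by rewrite powRD ?powRr1//; apply/implyP.
set z := 2 `^ _ => h; field.
by apply/eqP => z0; move: h; rewrite z0 invr0 mulr0 ltxx.
Qed.

(** Strong induction on the length: [half_split] takes out one interval [[v, u]] at the cost of two
    defects and leaves two shorter lists with at most half the control. The hypotheses are confined
    to a set [D] because [young_sum_cvg0] has its bounds only at partition points. *)
Lemma sewing_maximal D X w (kappa theta : R) : 1 < theta -> 0 <= kappa ->
  (forall x, D x -> X x x = 0) ->
  (forall x y, D x -> D y -> x <= y -> 0 <= w x y) ->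
  (forall x y z, D x -> D y -> D z -> x <= y -> y <= z ->
     w x y + w y z <= w x z) ->
  (forall x y z, D x -> D y -> D z -> x <= y -> y <= z ->
     `|X x z - X x y - X y z| <= kappa * w x z `^ theta) ->
  forall s a, path <=%R a s -> (forall x, x \in a :: s -> D x) ->
  `|X a (last a s) - partition_sum X a s| <=
    kappa * sewing_const theta * w a (last a s) `^ theta.
Proof.
move=> t1 k0 Xxx w0 wD XD s.
have c0 := ltW (sewing_const_gt0 _ t1).
have [n] := ubnP (size s); elim: n s => // n IH s sn a as_ sD.
have [s0|s0] := eqVneq s [::].
  rewrite s0 partition_sum_nil /= Xxx ?subr0 ?normr0; last first.
    by apply: sD; rewrite mem_head.
  by rewrite mulr_ge0 ?powR_ge0// mulr_ge0.
have [s1 [u [s2 [sE h1 h2]]]] := half_split D w a s s0 as_ sD w0 wD.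
set b := last a s in h1 h2 *; set v := last a s1 in h1 *.
have Db : D b by apply: sD; exact: mem_last.
have Da : D a by apply: sD; exact: mem_head.
have us : u \in a :: s by rewrite sE inE mem_cat mem_head !orbT.
have vs : v \in a :: s.
  by rewrite sE -cat_cons mem_cat /v mem_last.
have ab : a <= b by apply: (mem_last_path _ _ as_); exact: mem_head.
have vb := mem_last_path _ _ as_ _ vs.
have ub := mem_last_path _ _ as_ _ us.
have av := mem_head_path _ _ as_ _ vs.
have := as_; rewrite sE cat_path /= -/v => /andP[p1 /andP[vu p2]].
have bE : last u s2 = b by rewrite /b sE last_cat.
have t0 : 0 <= theta by lra.
have wab := w0 a b Da Db ab.
have wav := w0 a v Da (sD _ vs) av.
have wub := w0 u b (sD _ us) Db ub.
have i1 : `|X a v - partition_sum X a s1| <=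
    kappa * sewing_const theta * (w a b `^ theta * 2 `^ (- theta)).
  apply: le_trans (_ : _ <= kappa * sewing_const theta * w a v `^ theta) _.
    apply: IH => //.
      rewrite (leq_trans _ (n:=size s))//; last by rewrite sE size_cat /= -addSnnS leq_addr.
    by move=> x xs; apply: sD; rewrite sE -cat_cons mem_cat xs.
  rewrite ler_wpM2l//; first by rewrite mulr_ge0.
  rewrite powRN -powR_inv1 ?powR_ge0//.
  rewrite powRAC powR_inv1// -powRM ?invr_ge0//.
  by rewrite ge0_ler_powR// nnegrE divr_ge0.
have i2 : `|X u b - partition_sum X u s2| <=
    kappa * sewing_const theta * (w a b `^ theta * 2 `^ (- theta)).
  apply: le_trans (_ : _ <= kappa * sewing_const theta * w u b `^ theta) _.
    rewrite -bE; apply: IH => //.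
      rewrite (leq_trans _ (n:=size s))//; last by rewrite sE size_cat /= addnS ltnS leq_addl.
    by move=> x xs; apply: sD; rewrite sE -cat_cons mem_cat xs orbT.
  rewrite ler_wpM2l//; first by rewrite mulr_ge0.
  rewrite powRN -powR_inv1 ?powR_ge0//.
  rewrite powRAC powR_inv1// -powRM ?invr_ge0//.
  by rewrite ge0_ler_powR// nnegrE divr_ge0.
have i3 := XD a v b Da (sD _ vs) Db av vb.
have i4 : `|X v b - X v u - X u b| <= kappa * w a b `^ theta.
  apply: (le_trans (XD v u b (sD _ vs) (sD _ us) Db vu ub)).
  have wvb := w0 v b (sD _ vs) Db vb.
  rewrite ler_wpM2l// ge0_ler_powR ?nnegrE//.
  by have := wD a v b Da (sD _ vs) Db av vb; have := w0 a v Da (sD _ vs) av; lra.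
rewrite partition_sum_cat partition_sum_cons -/v.
have -> : X a b - (partition_sum X a s1 + (X v u + partition_sum X u s2)) =
  (X a b - X a v - X v b) + (X v b - X v u - X u b) +
  (X a v - partition_sum X a s1) + (X u b - partition_sum X u s2) by ring.
have E : kappa * sewing_const theta * w a b `^ theta =
  kappa * w a b `^ theta + kappa * w a b `^ theta +
  kappa * sewing_const theta * (w a b `^ theta * 2 `^ (- theta)) +
  kappa * sewing_const theta * (w a b `^ theta * 2 `^ (- theta)).
  rewrite -{1}(sewing_const_fix theta t1); ring.
rewrite E; apply: le_trans (ler_normD _ _) _; apply: lerD i2.
apply: le_trans (ler_normD _ _) _; apply: lerD i1.
by apply: le_trans (ler_normD _ _) _; exact: lerD i4.
Qed.

(** The inequality is weak because clipped and merged lists repeat points. *)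
Definition fine_step (delta x y : R) := (x <= y) && (y - x < delta).

Lemma fine_path_le delta (a : R) s : path (fine_step delta) a s -> path <=%R a s.
Proof. by apply: sub_path => x y /andP[]. Qed.

(** The local error is linear in the control, so adding it up over the intervals of the coarse list
    uses superadditivity only. *)
Lemma refinement_bound X w (T K delta : R) : 0 <= K -> control T w ->
  0 < delta ->
  (forall a s, 0 <= a -> path <=%R a s -> last a s <= T ->
     last a s - a < delta ->
     `|X a (last a s) - partition_sum X a s| <= K * w a (last a s)) ->
  forall s s' a, 0 <= a -> last a s <= T -> path (fine_step delta) a s ->
    path <=%R a s' -> last a s' = last a s -> subseq s s' ->
  `|partition_sum X a s - partition_sum X a s'| <= K * w a (last a s).
Proof.
move=> K0 [w0 wD] d0 H; elim=> [|u s IH] s' a a0 aT ps ps' ls sub.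
  rewrite /= partition_sum_nil.
  have h1 := H a s' a0 ps'; have h2 := H a [::] a0 isT.
  rewrite ls /= subrr in h1; rewrite /= subrr partition_sum_nil subr0 in h2.
  have h3 := wD a a a a0 (lexx _) (lexx _) aT.
  have h4 := w0 a a a0 (lexx _) aT.
  have w00 : w a a = 0 by lra.
  move: (h1 aT d0) (h2 aT d0); rewrite w00 mulr0 => e1 e2.
  have -> : 0 - partition_sum X a s' =
    (X a a - partition_sum X a s') - X a a by ring.
  by apply: (le_trans (ler_normB _ _)); lra.
move: ps ls aT => /= /andP[/andP[au uad] ps] ls aT.
have us' : u \in s' by apply: (mem_subseq sub); exact: mem_head.
have [s1 [s2 sE ns1]] : {s1 & {s2 | s' = s1 ++ u :: s2 & u \notin s1}}.
  exists (take (index u s') s'), (drop (index u s').+1 s').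
    by rewrite -{1}(cat_take_drop (index u s') s') (drop_nth u) ?index_mem// nth_index.
  by rewrite in_take ?index_size// ltnn.
have sub2 : subseq s s2.
  move: sub; rewrite sE; elim: (s1) ns1 => [|x s1' IH1] /=; first by rewrite eqxx.
  by rewrite inE negb_or eq_sym => /andP[/negPf-> /IH1].
move: ps'; rewrite sE cat_path /= => /andP[p1 /andP[vu p2]].
have pcat : path <=%R a (rcons s1 u) by rewrite rcons_path p1.
have ls2 : last u s2 = last u s by rewrite -ls sE last_cat.
have ult : u <= last u s.
  by apply: (mem_last_path _ _ (fine_path_le _ _ _ ps)); exact: mem_head.
have h1 := H a (rcons s1 u) a0 pcat.
rewrite last_rcons in h1.
have uT : u <= T by exact: le_trans ult aT.
have {}h1 := h1 uT uad.
have h2 := IH s2 u (le_trans a0 au) aT ps p2 ls2 sub2.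
have h3 := wD a u (last u s) a0 au ult aT.
rewrite -cats1 partition_sum_cat partition_sum_cons partition_sum_nil addr0 in h1.
rewrite partition_sum_cons partition_sum_cat partition_sum_cons.
have -> : X a u + partition_sum X u s - (partition_sum X a s1 +
    (X (last a s1) u + partition_sum X u s2)) =
  (X a u - (partition_sum X a s1 + X (last a s1) u)) +
  (partition_sum X u s - partition_sum X u s2) by ring.
apply: (le_trans (ler_normD _ _)); apply: (le_trans (lerD h1 h2)).
by rewrite -mulrDr ler_wpM2l.
Qed.
End Sewing.

(** * Controlled two-parameter functions and defects *)

Section Classes.
Context {R : realType}.
Implicit Types (X Y w : R -> R -> R) (T : R).

Lemma controlD T w1 w2 : control T w1 -> control T w2 ->
  control T (fun s t => w1 s t + w2 s t).
Proof.
move=> [a1 b1] [a2 b2]; split=> [s t s0 st tT|s u t s0 su ut tT].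
  by rewrite addr_ge0 ?a1 ?a2.
by have := b1 s u t s0 su ut tT; have := b2 s u t s0 su ut tT; lra.
Qed.

Lemma controlZ T c w : 0 <= c -> control T w ->
  control T (fun s t => c * w s t).
Proof.
move=> c0 [a1 b1]; split=> [s t s0 st tT|s u t s0 su ut tT].
  by rewrite mulr_ge0 ?a1.
by rewrite -mulrDr ler_wpM2l ?b1.
Qed.

Lemma control0 T : control T (fun _ _ => 0 : R).
Proof. by split=> *; rewrite ?addr0. Qed.

Lemma control_le T w s s' t' t : control T w -> 0 <= s -> s <= s' -> s' <= t' ->
  t' <= t -> t <= T -> w s' t' <= w s t.
Proof.
move=> [a b] s0 h1 h2 h3 h4.
have := b s s' t s0 h1 (le_trans h2 h3) h4.
have := b s' t' t (le_trans s0 h1) h2 h3 h4.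
have := a s s' s0 h1 (le_trans h2 (le_trans h3 h4)).
have := a t' t (le_trans s0 (le_trans h1 h2)) h3 h4.
lra.
Qed.

(* The control need not be continuous: the jumps of a path are dealt with by
   [small_osc] alone. *)
Definition holder T alpha X := exists w, control T w /\
  forall s t, 0 <= s -> s <= t -> t <= T -> `|X s t| <= w s t `^ alpha.

(* [tau] collects the large jumps: for the increments of a path, this is what
   being cadlag amounts to (see [cadlag_small_osc]). *)
Definition small_osc T X := forall e, 0 < e -> exists tau : seq R,
  forall a b, 0 <= a -> a <= b -> b <= T ->
  (forall x, x \in tau -> ~~ (a < x <= b)) -> `|X a b| <= e.

(** The control is fixed before [kappa], and only [delta] depends on [kappa]: the sewing error,
    [kappa] times a quantity built from [w], can then be made small. *)
Definition small_defect T theta (D : R -> R -> R -> R) := exists w,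
  control T w /\ forall kappa, 0 < kappa -> exists2 delta, 0 < delta &
  forall s u t, 0 <= s -> s <= u -> u <= t -> t <= T -> t - s < delta ->
  `|D s u t| <= kappa * w s t `^ theta.

Lemma holder_bounded T alpha X : 0 <= alpha -> holder T alpha X -> exists2 M, 0 < M &
  forall s t, 0 <= s -> s <= t -> t <= T -> `|X s t| <= M.
Proof.
move=> a0 [w [wc Xw]]; exists (w 0 T `^ alpha + 1).
  by rewrite ltr_wpDl ?powR_ge0.
move=> s t s0 st tT; apply: (le_trans (Xw s t s0 st tT)).
rewrite ler_wpDr// ge0_ler_powR ?nnegrE//.
- by case: wc => + _; apply.
- by case: wc => + _; apply => //; rewrite (le_trans s0)// (le_trans st).
- exact: (control_le T).
Qed.

Lemma holder_le T alpha X Y : holder T alpha Y ->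
  (forall s t, 0 <= s -> s <= t -> t <= T -> `|X s t| <= `|Y s t|) ->
  holder T alpha X.
Proof.
move=> [w [wc Yw]] XY; exists w; split => // s t s0 st tT.
exact: le_trans (XY _ _ s0 st tT) (Yw _ _ s0 st tT).
Qed.

Lemma holderM T alpha beta X Y : 0 < alpha -> 0 < beta ->
  holder T alpha X -> holder T beta Y ->
  holder T (alpha + beta) (fun s t => X s t * Y s t).
Proof.
move=> a0 b0 [w1 [c1 h1]] [w2 [c2 h2]].
exists (fun s t => w1 s t + w2 s t); split; first exact: controlD.
move=> s t s0 st tT; have [p1 _] := c1; have [p2 _] := c2.
have {}p1 := p1 s t s0 st tT; have {}p2 := p2 s t s0 st tT.
rewrite normrM powRD; last by apply/implyP; rewrite gt_eqF// addr_gt0.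
apply: ler_pM => //.
  apply: (le_trans (h1 _ _ s0 st tT)); apply: ge0_ler_powR; rewrite ?nnegrE; lra.
apply: (le_trans (h2 _ _ s0 st tT)); apply: ge0_ler_powR; rewrite ?nnegrE; lra.
Qed.

Lemma holder_weight T alpha (c X : R -> R -> R) M : 0 < alpha ->
  (forall s t, 0 <= s -> s <= t -> t <= T -> `|c s t| <= M) -> holder T alpha X ->
  holder T alpha (fun s t => c s t * X s t).
Proof.
move=> a0 cM [w [wc Xw]]; exists (fun s t => (`|M| `^ alpha^-1) * w s t); split.
  by apply: controlZ => //; exact: powR_ge0.
move=> s t s0 st tT; have [w0 _] := wc.
rewrite normrM powRM ?powR_ge0//; last exact: w0.
rewrite -powRrM mulVf ?gt_eqF// powRr1//; apply: ler_pM => //.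
  by apply: le_trans (ler_norm _); exact: cM.
exact: Xw.
Qed.

Lemma holderD T alpha X Y : 0 < alpha -> holder T alpha X -> holder T alpha Y ->
  holder T alpha (fun s t => X s t + Y s t).
Proof.
move=> a0 [w1 [c1 h1]] [w2 [c2 h2]].
have H : holder T alpha (fun s t => 2 * (w1 s t + w2 s t) `^ alpha).
  apply: (holder_weight T alpha (fun _ _ => 2) _ 2) => //; first by move=> *; rewrite ger0_norm.
  exists (fun s t => w1 s t + w2 s t); split; first exact: controlD.
  by move=> *; rewrite ger0_norm// powR_ge0.
apply: (holder_le _ _ _ _ H) => s t s0 st tT.
have [p1 _] := c1; have [p2 _] := c2.
have {}p1 := p1 s t s0 st tT; have {}p2 := p2 s t s0 st tT.
rewrite [leRHS]ger0_norm ?mulr_ge0 ?powR_ge0// mulr2n mulrDl mul1r.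
apply: le_trans (ler_normD _ _) _; apply: lerD.
  by apply: (le_trans (h1 _ _ s0 st tT)); apply: ge0_ler_powR; rewrite ?nnegrE; lra.
by apply: (le_trans (h2 _ _ s0 st tT)); apply: ge0_ler_powR; rewrite ?nnegrE; lra.
Qed.

Lemma small_osc_le T X Y : small_osc T Y ->
  (forall s t, 0 <= s -> s <= t -> t <= T -> `|X s t| <= `|Y s t|) ->
  small_osc T X.
Proof.
move=> oY XY e e0; have [tau h] := oY e e0; exists tau => a b a0 ab bT nt.
exact: le_trans (XY _ _ a0 ab bT) (h _ _ a0 ab bT nt).
Qed.

Lemma small_oscD T X Y : small_osc T X -> small_osc T Y ->
  small_osc T (fun s t => X s t + Y s t).
Proof.
move=> oX oY e e0; have e20 : 0 < e / 2 by rewrite divr_gt0.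
have [t1 h1] := oX _ e20; have [t2 h2] := oY _ e20.
exists (t1 ++ t2) => a b a0 ab bT nt; apply: le_trans (ler_normD _ _) _.
have i1 := h1 a b a0 ab bT; have i2 := h2 a b a0 ab bT.
rewrite (splitr e); apply: lerD; [apply: i1|apply: i2] => x xt; apply: nt;
by rewrite mem_cat xt ?orbT.
Qed.

Lemma small_osc_weight T (c X : R -> R -> R) M :
  (forall s t, 0 <= s -> s <= t -> t <= T -> `|c s t| <= M) -> small_osc T X ->
  small_osc T (fun s t => c s t * X s t).
Proof.
move=> cM oX e e0.
have M0 : 0 < `|M| + 1 by rewrite ltr_wpDl.
have [tau h] := oX (e / (`|M| + 1)) (divr_gt0 e0 M0).
exists tau => a b a0 ab bT nt; rewrite normrM.
have {}h := h a b a0 ab bT nt.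
apply: le_trans (_ : _ <= (`|M| + 1) * (e / (`|M| + 1))) _.
  apply: ler_pM => //; apply: (le_trans (cM _ _ a0 ab bT)).
  by rewrite ler_wpDr// ler_norm.
by rewrite mulrC divfK ?gt_eqF.
Qed.

Lemma small_osc_limit T X : (forall e, 0 < e -> exists2 Y, small_osc T Y &
    forall s t, 0 <= s -> s <= t -> t <= T -> `|X s t - Y s t| <= e) ->
  small_osc T X.
Proof.
move=> H e e0; have e20 : 0 < e / 2 by rewrite divr_gt0.
have [Y oY XY] := H _ e20; have [tau h] := oY _ e20.
exists tau => a b a0 ab bT nt.
have -> : X a b = (X a b - Y a b) + Y a b by ring.
apply: le_trans (ler_normD _ _) _; rewrite (splitr e).
by apply: lerD; [exact: XY|exact: h].
Qed.

Lemma small_osc0 T : small_osc T (fun _ _ => 0).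
Proof. by move=> e e0; exists [::] => *; rewrite normr0 ltW. Qed.

Lemma small_osc_sum T (I : Type) (r : seq I) (X : I -> R -> R -> R) :
  (forall i, small_osc T (X i)) -> small_osc T (fun s t => \sum_(i <- r) X i s t).
Proof.
move=> oX; elim: r => [|i r IH].
  by apply: (small_osc_le _ _ _ (small_osc0 T)) => *; rewrite big_nil.
by apply: (small_osc_le _ _ _ (small_oscD _ _ _ (oX i) IH)) => *; rewrite big_cons.
Qed.

(** Stopping at [c] creates no new exceptional points, since the stopped interval
    [(min c a, min c b]] lies in [(a, b]]. *)
Lemma small_osc_min T (f : R -> R) c : 0 <= c -> small_osc T (incr f) ->
  small_osc T (incr (fun t => f (Num.min c t))).
Proof.
move=> c0 of_ e e0; have [tau h] := of_ e e0; exists tau => a b a0 ab bT nt.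
apply: h.
- by rewrite le_min c0 a0.
- by rewrite le_min !ge_min lexx ab !orbT.
- by rewrite ge_min bT orbT.
- move=> x /nt; apply: contra; rewrite gt_min le_min => /andP[/orP[cx|->] /andP[xc ->]] //.
  by move: (lt_le_trans cx xc); rewrite ltxx.
Qed.

Lemma seq_gap (tau : seq R) : exists2 delta, 0 < delta &
  forall x y, x \in tau -> y \in tau -> x < y -> delta <= y - x.
Proof.
pose L := [seq z <- [seq y - x | x <- tau, y <- tau] | 0 < z].
have [d d0 dL] : exists2 delta, 0 < delta & forall z, z \in L -> delta <= z.
  have : forall z, z \in L -> 0 < z by move=> z; rewrite mem_filter => /andP[].
  elim: L => [|z L IH] L0; first by exists 1.
  have [|d d0 dL] := IH; first by move=> y yL; apply: L0; rewrite inE yL orbT.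
  exists (Num.min z d); first by rewrite lt_min d0 L0 ?mem_head.
  by move=> y; rewrite inE => /orP[/eqP->|/dL]; rewrite ge_min ?lexx// => ->; rewrite orbT.
exists d => // x y xt yt xy; apply: dL; rewrite mem_filter subr_gt0 xy /=.
by apply/allpairsP; exists (x, y).
Qed.

(* A short interval contains at most one of the finitely many exceptional
   points, so [s, u] and [u, t] are not both affected. *)
Lemma small_osc_alternative T X Y e : small_osc T X -> small_osc T Y -> 0 < e ->
  exists2 delta, 0 < delta & forall s u t, 0 <= s -> s <= u -> u <= t -> t <= T ->
    t - s < delta -> `|X s u| <= e \/ `|Y u t| <= e.
Proof.
move=> oX oY e0; have [t1 h1] := oX e e0; have [t2 h2] := oY e e0.
have [d d0 dg] := seq_gap (t1 ++ t2); exists d => // s u t s0 su ut tT tsd.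
have [/hasP[x x1 /andP[sx xu]]|n1] := boolP (has (fun x => s < x <= u) t1); last first.
  left; apply: h1 => //; first by rewrite (le_trans ut).
  by move=> x xt; apply: contra n1 => ?; apply/hasP; exists x.
right; apply: h2 => //; first by rewrite (le_trans s0).
move=> y yt; apply/negP => /andP[uy yt'].
have := dg x y; rewrite !mem_cat x1 yt orbT => /(_ isT isT (le_lt_trans xu uy)); lra.
Qed.

Lemma small_defectD T theta D1 D2 : 0 <= theta -> small_defect T theta D1 ->
  small_defect T theta D2 -> small_defect T theta (fun s u t => D1 s u t + D2 s u t).
Proof.
move=> th0 [w1 [c1 h1]] [w2 [c2 h2]].
exists (fun s t => w1 s t + w2 s t); split; first exact: controlD.
move=> k k0; have k20 : 0 < k / 2 by rewrite divr_gt0.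
have [d1 d10 i1] := h1 _ k20; have [d2 d20 i2] := h2 _ k20.
exists (Num.min d1 d2); first by rewrite lt_min d10.
move=> s u t s0 su ut tT; rewrite lt_min => /andP[j1 j2].
have [p1 _] := c1; have [p2 _] := c2.
have {}p1 := p1 s t s0 (le_trans su ut) tT; have {}p2 := p2 s t s0 (le_trans su ut) tT.
apply: le_trans (ler_normD _ _) _.
rewrite (splitr k) mulrDl; apply: lerD.
  apply: (le_trans (i1 s u t s0 su ut tT j1)); apply: ler_wpM2l; first exact: ltW.
  by apply: ge0_ler_powR; rewrite ?nnegrE; lra.
apply: (le_trans (i2 s u t s0 su ut tT j2)); apply: ler_wpM2l; first exact: ltW.
by apply: ge0_ler_powR; rewrite ?nnegrE; lra.
Qed.

Lemma small_defect_le T theta D1 D2 : small_defect T theta D2 ->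
  (forall s u t, 0 <= s -> s <= u -> u <= t -> t <= T -> `|D1 s u t| <= `|D2 s u t|) ->
  small_defect T theta D1.
Proof.
move=> [w [wc h]] le12; exists w; split => // k k0; have [d d0 i] := h _ k0.
exists d => // s u t s0 su ut tT dd.
exact: le_trans (le12 _ _ _ s0 su ut tT) (i _ _ _ s0 su ut tT dd).
Qed.

Lemma small_defect_sum T theta (I : Type) (r : seq I) (D : I -> R -> R -> R -> R) :
  0 <= theta -> (forall i, small_defect T theta (D i)) ->
  small_defect T theta (fun s u t => \sum_(i <- r) D i s u t).
Proof.
move=> th0 oD; elim: r => [|i r IH].
  exists (fun _ _ => 0); split; first exact: control0.
  move=> k k0; exists 1 => // *.
  by rewrite big_nil normr0 mulr_ge0 ?powR_ge0// ltW.
by apply: (small_defect_le _ _ _ _ (small_defectD _ _ _ _ th0 (oD i) IH)) => *; rewrite big_cons.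
Qed.

(* The surplus [eta > 1] in the exponent is spent on smallness. *)
Lemma geometric_interpolation (eta e W x : R) : 1 < eta -> 0 <= e -> 0 <= W ->
  0 <= x -> x <= e -> x <= W `^ eta ->
  x <= e `^ (1 - (1 + eta) / 2 / eta) * W `^ ((1 + eta) / 2).
Proof.
move=> eta1 e0 W0 x0 xe xW; set lam := (1 + eta) / 2 / eta.
have eta0 : 0 < eta by lra.
have lamE : lam * eta = (1 + eta) / 2 by rewrite /lam divfK// gt_eqF.
have lam0 : 0 <= lam by rewrite /lam ltW// !divr_gt0//; lra.
have lam1 : 0 <= 1 - lam by rewrite subr_ge0 /lam ler_pdivrMr// mul1r; lra.
have -> : x = x `^ (1 - lam) * x `^ lam.
  by rewrite -powRD ?subrK ?powRr1//; apply/implyP; rewrite oner_eq0.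
apply: ler_pM; rewrite ?powR_ge0//; first by apply: ge0_ler_powR; rewrite ?nnegrE.
rewrite -lamE (mulrC lam) (powRrM _ eta lam).
by apply: ge0_ler_powR; rewrite ?nnegrE ?powR_ge0.
Qed.

Lemma small_defectM T alpha beta X Y : 0 < alpha -> 0 < beta -> 1 < alpha + beta ->
  holder T alpha X -> holder T beta Y -> small_osc T X -> small_osc T Y ->
  small_defect T ((1 + (alpha + beta)) / 2) (fun s u t => X s u * Y u t).
Proof.
move=> a0 b0 ab1 hX hY oX oY.
have [M1 M10 XM] := holder_bounded _ _ _ (ltW a0) hX.
have [M2 M20 YM] := holder_bounded _ _ _ (ltW b0) hY.
have [w1 [c1 h1]] := hX; have [w2 [c2 h2]] := hY.
exists (fun s t => w1 s t + w2 s t); split; first exact: controlD.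
(* [mu] is the weight of the small bound in [geometric_interpolation]; it is positive because
   [(1 + eta) / 2 < eta]. *)
set eta := alpha + beta; pose mu := 1 - (1 + eta) / 2 / eta.
have eta0 : 0 < eta by rewrite /eta; lra.
have mu0 : 0 < mu by rewrite subr_gt0 ltr_pdivrMr// mul1r /eta; lra.
move=> k k0; pose M := M1 + M2; have M0 : 0 < M by rewrite addr_gt0.
(* Chosen so that [e * M] to the power [mu] is [k]: one factor is at most [e], the other at most
   [M]. *)
pose e := k `^ mu^-1 / M; have e0 : 0 < e by rewrite divr_gt0// powR_gt0.
have [d d0 alt] := small_osc_alternative T X Y e oX oY e0.
exists d => // s u t s0 su ut tT tsd.
have u0 := le_trans s0 su; have uT := le_trans ut tT.
have small : `|X s u * Y u t| <= e * M.
  rewrite normrM; case: (alt s u t s0 su ut tT tsd) => h.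
    by apply: ler_pM => //; apply: le_trans (YM _ _ u0 ut tT) _; rewrite /M; lra.
  by rewrite mulrC; apply: ler_pM => //; apply: le_trans (XM _ _ s0 su uT) _; rewrite /M; lra.
have [p1 q1] := c1; have [p2 q2] := c2.
have r1 := p1 s u s0 su uT; have r2 := p2 u t u0 ut tT.
have r3 := p2 s u s0 su uT; have r4 := p1 u t u0 ut tT.
have m1 : w1 s u <= w1 s t + w2 s t.
  by have := q1 s u t s0 su ut tT; have := q2 s u t s0 su ut tT; lra.
have m2 : w2 u t <= w1 s t + w2 s t.
  by have := q1 s u t s0 su ut tT; have := q2 s u t s0 su ut tT; lra.
have W0 : 0 <= w1 s t + w2 s t by lra.
have big : `|X s u * Y u t| <= (w1 s t + w2 s t) `^ eta.
  rewrite normrM powRD; last by apply/implyP; rewrite gt_eqF.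
  apply: ler_pM => //.
    by apply: le_trans (h1 _ _ s0 su uT) _; apply: ge0_ler_powR; rewrite ?nnegrE // ltW.
  by apply: le_trans (h2 _ _ u0 ut tT) _; apply: ge0_ler_powR; rewrite ?nnegrE // ltW.
have eM0 : 0 <= e * M by rewrite mulr_ge0// ltW.
apply: le_trans (geometric_interpolation eta _ _ _ ab1 eM0 W0 (normr_ge0 _) small big) _.
apply: ler_wpM2r; first exact: powR_ge0.
by rewrite -/mu /e divfK ?gt_eqF// -powRrM mulVf ?gt_eqF// powRr1 // ltW.
Qed.

(** Each list is compared with the sorted union of the two, which refines both. The same [delta]
    serves every end point up to [T]. *)
Lemma sewing_cauchy T X theta : 0 <= T -> 1 < theta ->
  (forall x, 0 <= x <= T -> X x x = 0) ->
  small_defect T theta (fun s u t => X s t - X s u - X u t) ->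
  forall e, 0 < e -> exists2 delta, 0 < delta &
  forall s s', path (fine_step delta) 0 s -> path (fine_step delta) 0 s' ->
    last 0 s = last 0 s' -> last 0 s <= T ->
    `|partition_sum X 0 s - partition_sum X 0 s'| <= e.
Proof.
move=> T0 t1 Xxx [w [wc H]] e e0; have [w0 wD] := wc.
have C0 := sewing_const_gt0 _ t1.
pose W := w 0 T; have W0 : 0 <= W by exact: w0.
(* Bounding [w^theta] by [W^(theta-1) * w] makes the sewing error linear in [w], as
   [refinement_bound] requires. [kappa * Q] is the resulting total, and [Q + 1] avoids a division by
   zero. *)
pose Q := sewing_const theta * W `^ (theta - 1) * W.
have Cn := ltW C0; have Q0 : 0 <= Q by rewrite /Q mulr_ge0// mulr_ge0// powR_ge0.
pose kappa := e / 2 / (Q + 1).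
have k0 : 0 < kappa by rewrite !divr_gt0// ltr_wpDl.
have [d d0 HD] := H _ k0; exists d => // s1 s2 p1 p2 ls lT.
pose K := kappa * sewing_const theta * W `^ (theta - 1).
have kn := ltW k0.
have K0 : 0 <= K by rewrite /K mulr_ge0 ?powR_ge0// mulr_ge0.
have KW : K * W <= e / 2.
  have -> : K * W = kappa * Q by rewrite /K /Q; ring.
  rewrite /kappa mulrAC ler_pdivrMr ?ltr_wpDl//.
  by rewrite ler_pM2l ?divr_gt0// ler_wpDr.
have bound a s : 0 <= a -> path <=%R a s -> last a s <= T ->
    last a s - a < d ->
    `|X a (last a s) - partition_sum X a s| <= K * w a (last a s).
  move=> a0 ps sT sd; set b := last a s in sT sd *.
  have ab : a <= b by apply: (mem_last_path _ _ ps); exact: mem_head.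
  apply: (le_trans (sewing_maximal [set x | a <= x <= b] X w kappa theta t1
    (ltW k0) _ _ _ _ s a ps _)).
  - by move=> x /= /andP[? ?]; rewrite Xxx// (le_trans a0)//= (le_trans _ sT).
  - move=> x y /= /andP[ax _] /andP[_ yb] xy.
    by rewrite w0// ?(le_trans a0)// (le_trans yb).
  - move=> x y z /= /andP[ax _] _ /andP[_ zb] xy yz.
    by rewrite wD// ?(le_trans a0)// (le_trans zb).
  - move=> x y z /= /andP[ax _] _ /andP[_ zb] xy yz.
    by rewrite HD ?(le_trans a0 ax)// ?(le_trans zb)//; lra.
  - move=> x xs /=; rewrite (mem_head_path _ _ ps)//.
    exact: (mem_last_path _ _ ps).
  rewrite -/b /K -[leRHS]mulrA; apply: ler_wpM2l; first exact: mulr_ge0.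
  have wab := w0 a b a0 ab sT.
  rewrite -mulr_powRB1//; last by lra.
  rewrite mulrC; apply: ler_wpM2r => //; apply: ge0_ler_powR; rewrite ?nnegrE//.
    by lra.
  exact: (control_le T).
pose s' := sort <=%R (s1 ++ s2).
have p1' := fine_path_le _ _ _ p1; have p2' := fine_path_le _ _ _ p2.
have s'0 x : x \in s' -> 0 <= x <= last 0 s1.
  rewrite mem_sort mem_cat => /orP[] xs.
    by rewrite (mem_head_path _ _ p1') ?(mem_last_path _ _ p1')// inE xs orbT.
  by rewrite ls (mem_head_path _ _ p2') ?(mem_last_path _ _ p2')// inE xs orbT.
have ps' : path <=%R 0 s'.
  rewrite path_sortedE; last exact: le_trans.
  apply/andP; split; first by apply/allP => x /s'0/andP[].
  exact: sort_le_sorted.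
have l0 : 0 <= last 0 s1 by apply: (mem_last_path _ _ p1'); exact: mem_head.
have ls' : last 0 s' = last 0 s1.
  apply/eqP; rewrite eq_le; apply/andP; split.
    by have := mem_last 0 s'; rewrite inE => /orP[/eqP->//|/s'0/andP[]].
  apply: (mem_last_path _ _ ps').
  have := mem_last 0 s1; rewrite !inE => /orP[->//|h].
  by rewrite mem_sort mem_cat h orbT.
have sub1 : subseq s1 s'.
  by apply: sorted_subseq_sort_le; [exact: prefix_subseq|exact: path_sorted p1'].
have sub2 : subseq s2 s'.
  by apply: sorted_subseq_sort_le; [exact: suffix_subseq|exact: path_sorted p2'].
have wW b : 0 <= b -> b <= T -> K * w 0 b <= e / 2.
  move=> b0 bT; apply: le_trans KW; apply: ler_wpM2l => //.
  exact: (control_le T).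
have r1 := refinement_bound X w T K d K0 wc d0 bound s1 s' 0 (lexx _) lT p1 ps' ls' sub1.
rewrite ls in lT ls' l0.
have r2 := refinement_bound X w T K d K0 wc d0 bound s2 s' 0 (lexx _) lT p2 ps' ls' sub2.
rewrite ls in r1.
have := wW _ l0 lT.
have -> : partition_sum X 0 s1 - partition_sum X 0 s2 =
  (partition_sum X 0 s1 - partition_sum X 0 s') -
  (partition_sum X 0 s2 - partition_sum X 0 s') by ring.
by move=> ?; apply: le_trans (ler_normB _ _) _; lra.
Qed.

End Classes.

Lemma uniform_cvgP {R : realType} {V : normedModType R} (A : set R)
    (f_ : nat -> R -> V) (f : R -> V) :
  {uniform A, f_ n @[n --> \oo] --> f} <->
  forall e, 0 < e -> \forall n \near \oo, forall y, A y -> `|f y - f_ n y| < e.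
Proof.
split=> [H e e0|H].
  apply: (H [set h | forall y, A y -> `|f y - h y| < e]).
  apply/uniform_nbhs; exists [set xy | ball xy.1 e xy.2]; split.
    exact: entourage_ball (PosNum e0).
  by move=> h /= hb y Ay; have := hb y Ay; rewrite -ball_normE.
move=> Q /uniform_nbhs[E [entE EQ]].
move: entE; rewrite -entourage_ballE => -[e e0 eE].
near=> n; apply: EQ => y Ay; apply: eE => /=; rewrite -ball_normE /=.
by move: y Ay; near: n; exact: H.
Unshelve. all: by end_near. Qed.

(** * Cadlag paths and p-variation *)

Section Cadlag.
Context {R : realType}.

Lemma cadlag_entry {T : R} {m n} (f : R -> 'M[R]_(m, n)) i j :
  cadlag 0 T f -> cadlag 0 T (fun t => f t i j).
Proof.
move=> [rc ll]; split=> [t /rc h|t /ll [l h]].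
  exact: (cvg_comp _ _ h (@coord_continuous _ _ _ i j (f t))).
exists (l i j); exact: (cvg_comp _ _ h (@coord_continuous _ _ _ i j l)).
Qed.

(** A compactness argument through a supremum: let [c] be the supremum of the [x] for which [[0, x]]
    has a suitable finite list. The left limit at [c] shows that [c] itself is suitable, and
    right-continuity at [c] would carry the property beyond [c < T]. *)
Lemma cadlag_small_osc (T : R) (f : R -> R) : 0 <= T -> cadlag 0 T f ->
  small_osc T (incr f).
Proof.
move=> T0 [rc ll] e e0.
have e20 : 0 < e / 2 by rewrite divr_gt0.
pose good x := exists tau : seq R, forall a b, 0 <= a -> a <= b -> b <= x ->
  (forall y, y \in tau -> ~~ (a < y <= b)) -> `|incr f a b| <= e.
pose E := [set x | 0 <= x <= T /\ good x].
have good0 : good 0.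
  exists [::] => a b a0 ab b0 _; have -> : b = a by apply/le_anti; rewrite ab (le_trans b0).
  by rewrite /incr subrr normr0 ltW.
have E0 : E 0 by split; rewrite ?lexx.
have Eub : has_ubound E by exists T => x [/andP[]].
pose c := sup E.
have c0 : 0 <= c by exact: ub_le_sup E0.
have cT : c <= T by apply: ge_sup; [exists 0|move=> x [/andP[]]].
have goodc : good c.
  have [c0'|c0'] := eqVneq c 0; first by rewrite c0'.
  have cp : 0 < c by rewrite lt_neqAle eq_sym c0'.
  have [l /cvgr_dist_le/(_ _ e20)] := ll c (introT andP (conj cp cT)).
  rewrite /at_left near_withinE => /nbhs_ballP[d /= d0 Hd].
  have [x Ex cx] := sup_adherent d0 (conj (ex_intro _ 0 E0) Eub).
  have [_ [tau ht]] := Ex.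
  (* Avoiding [c] and [x] leaves three cases: [a = b = c]; both points in [[x, c[], where [f] is
     close to its left limit; or both before [x], where [tau] applies. *)
  exists [:: x, c & tau] => a b a0 ab bc nt.
  have := nt c; rewrite !inE eqxx orbT => /(_ isT); rewrite negb_and -leNgt -ltNge.
  move=> /orP[ca|bc'].
    have -> : b = a by apply/le_anti; rewrite ab (le_trans bc).
    by rewrite /incr subrr normr0 ltW.
  have := nt x; rewrite !inE eqxx => /(_ isT); rewrite negb_and -leNgt -ltNge.
  move=> /orP[xa|bx]; last first.
    by apply: ht => //; [exact: ltW|move=> y yt; apply: nt; rewrite !inE yt !orbT].
  have near_l z : x <= z -> z < c -> `|l - f z| <= e / 2.
    move=> xz zc; apply: Hd => //; rewrite -ball_normE /= ger0_norm; last by lra.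
    by move: cx; rewrite -/c; lra.
  have h1 := near_l b (le_trans xa ab) bc'.
  have h2 := near_l a xa (le_lt_trans ab bc').
  rewrite /incr; have -> : f b - f a = (l - f a) - (l - f b) by ring.
  by apply: le_trans (ler_normB _ _) _; lra.
have [ceq|cneq] := eqVneq c T; first by rewrite -ceq.
have cltT : c < T by rewrite lt_neqAle cneq.
have := rc c; rewrite c0 cltT => /(_ isT) /cvgr_dist_le/(_ _ e20).
rewrite /at_right near_withinE => /nbhs_ballP[d /= d0 Hd].
pose c' := Num.min (c + d / 2) T.
have cc' : c < c' by rewrite lt_min cltT ltrDl divr_gt0.
suff : E c' by move/(ub_le_sup Eub); rewrite leNgt -/c cc'.
split; first by rewrite (le_trans c0 (ltW cc')) /c' ge_min lexx orbT.
have [tau ht] := goodc; exists (c :: tau) => a b a0 ab bc nt.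
have := nt c; rewrite !inE eqxx => /(_ isT); rewrite negb_and -leNgt -ltNge.
move=> /orP[ca|bc']; last first.
  by apply: ht => //; [exact: ltW|move=> y yt; apply: nt; rewrite !inE yt !orbT].
have near_c z : c <= z -> z <= c' -> `|f c - f z| <= e / 2.
  rewrite le_eqVlt => /orP[/eqP<- _|cz zc]; first by rewrite subrr normr0 ltW.
  apply: Hd => //; rewrite -ball_normE /= ler0_norm; last by lra.
  move: zc; rewrite /c' le_min => /andP[zc _]; lra.
have h1 := near_c b (le_trans ca ab) bc.
have h2 := near_c a ca (le_trans ab bc).
rewrite /incr; have -> : f b - f a = (f c - f a) - (f c - f b) by ring.
by apply: le_trans (ler_normB _ _) _; lra.
Qed.

(** [small_osc] contains right-continuity: close enough to [x], no exceptional point lies in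
    [(x, rho n]]. This also applies to the integral of [S], for which only [small_osc] is
    established. *)
Lemma small_osc_right_cvg (T : R) (f : R -> R) x (rho : nat -> R) :
  small_osc T (incr f) -> 0 <= x -> (forall n, x <= rho n <= T) ->
  rho n @[n --> \oo] --> x -> f (rho n) @[n --> \oo] --> f x.
Proof.
move=> of_ x0 xr rx; apply/cvgrPdist_le => e e0.
(* With [x] added to the list, the gap also separates [x] from the next exceptional point. *)
have [tau ht] := of_ e e0; have [d d0 dg] := seq_gap (x :: tau).
have dL y : y \in tau -> x < y -> x + d <= y.
  by move=> yt xy; rewrite -lerBrDl; apply: dg; rewrite ?inE ?eqxx ?yt ?orbT.
have /cvgrPdist_lt/(_ d d0) := rx.
apply: filterS => n; have /andP[xn nT] := xr n.
rewrite distrC ger0_norm ?subr_ge0// => rd.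
rewrite distrC; apply: ht => // y yt; apply/negP => /andP[xy yr].
by have := dL y yt xy; lra.
Qed.

End Cadlag.

(** * Controls obtained from bounded variation sums *)

Section Variation.
Context {R : realType}.

(** The control is the variation itself, the supremum of the sums over partitions of [[s, t]].
    Concatenation gives superadditivity, and completing a partition of [[s, t]] to one of [[0, T]]
    gives finiteness. *)
Lemma bounded_sums_control (T : R) (phi : R -> R -> R) C : 0 < T ->
  (forall s t, 0 <= phi s t) -> (forall s, phi s s = 0) ->
  (forall l, itv_partition 0 T l -> partition_sum phi 0 l <= C) ->
  exists w, control T w /\
    forall s t, 0 <= s -> s <= t -> t <= T -> phi s t <= w s t.
Proof.
move=> T0 phi0 phixx phiC.
pose Q s t := [set partition_sum phi s l | l in itv_partition s t].
have psum0 a l : 0 <= partition_sum phi a l by apply: sumr_ge0.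
have part s t : s <= t -> exists2 l, itv_partition s t l & phi s t = partition_sum phi s l.
  rewrite le_eqVlt => /orP[/eqP->|st].
    by exists [::]; [split => //=|rewrite partition_sum_nil phixx].
  exists [:: t]; first exact: itv_partition1.
  by rewrite partition_sum_cons partition_sum_nil addr0.
have QC s t : 0 <= s -> t <= T -> ubound (Q s t) C.
  move=> s0 tT _ [l ltP <-].
  have [l1 l1P _] := part _ _ s0; have [l2 l2P _] := part _ _ tT.
  have := phiC _ (itv_partition_cat l1P (itv_partition_cat ltP l2P)).
  rewrite !partition_sum_cat; have [_ /eqP->] := l1P; have [_ /eqP->] := ltP.
  by have := psum0 0 l1; have := psum0 t l2; lra.
have Qne s t : s <= t -> Q s t !=set0.
  by move=> /part[l lP _]; exists (partition_sum phi s l), l.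
have Qhs s t : 0 <= s -> s <= t -> t <= T -> has_sup (Q s t).
  by move=> s0 st tT; split; [exact: Qne|exists C; exact: QC].
exists (fun s t => sup (Q s t)); split.
  split=> [s t s0 st tT|s u t s0 su ut tT].
    have [l lP _] := part _ _ st; apply: (le_trans (psum0 s l)).
    by apply: ub_le_sup; [exists C; exact: QC|exists l].
  rewrite -lerBrDr; apply: ge_sup; first exact: Qne.
  move=> _ [l1 l1P <-]; rewrite lerBrDr -lerBrDl; apply: ge_sup; first exact: Qne.
  move=> _ [l2 l2P <-]; rewrite lerBrDl; apply: ub_le_sup.
    by exists C; exact: QC.
  exists (l1 ++ l2); first exact: itv_partition_cat l1P l2P.
  by rewrite partition_sum_cat; have [_ /eqP->] := l1P.
move=> s t s0 st tT; have [l lP ->] := part _ _ st.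
by apply: ub_le_sup; [exists C; exact: QC|exists l].
Qed.

Lemma entry_le_enorm {m n} (x : 'M[R]_(m, n)) i j : `|x i j| <= enorm x.
Proof.
rewrite /enorm -sqrtr_sqr ler_wsqrtr// (bigD1 i)//= (bigD1 j)//=.
rewrite -addrA lerDl addr_ge0//; last by apply: sumr_ge0 => *; apply: sumr_ge0 => *; exact: sqr_ge0.
by apply: sumr_ge0 => *; exact: sqr_ge0.
Qed.

Lemma enorm0 {m n} : enorm (0 : 'M[R]_(m, n)) = 0.
Proof.
rewrite /enorm big1 ?sqrtr0// => i _; rewrite big1// => j _.
by rewrite mxE expr0n.
Qed.

Lemma powR_le_root (x y p : R) : 0 < p -> 0 <= x -> x `^ p <= y -> x <= y `^ p^-1.
Proof.
move=> p0 x0 xy; have -> : x = (x `^ p) `^ p^-1.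
  by rewrite -powRrM mulfV ?gt_eqF// powRr1.
apply: ge0_ler_powR; rewrite ?nnegrE ?powR_ge0//; first by rewrite invr_ge0 ltW.
exact: le_trans (powR_ge0 _ _) xy.
Qed.

Lemma pvar_holder {m n} (T p : R) (A : R -> R -> 'M[R]_(m, n)) i j :
  0 < T -> 0 < p -> (forall s, A s s = 0) -> (pvar p 0 T A < +oo)%E ->
  holder T p^-1 (fun s t => A s t i j).
Proof.
move=> T0 p0 Axx; rewrite /pvar => /lty_poweRy.
rewrite invr_eq0 gt_eqF// => /(_ isT) Alty.
pose phi s t := enorm (A s t) `^ p.
have [w [wc wphi]] : exists w, control T w /\
    forall s t, 0 <= s -> s <= t -> t <= T -> phi s t <= w s t.
  apply: (bounded_sums_control T phi (fine (ereal_sup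
    [set (partition_sum phi 0 s)%:E | s in itv_partition 0 T]))) => //.
  - by move=> s t; exact: powR_ge0.
  - by move=> s; rewrite /phi Axx enorm0 powR0// gt_eqF.
  - move=> l lP; rewrite -lee_fin.
    have lle : ((partition_sum phi 0 l)%:E <= ereal_sup
      [set (partition_sum phi 0 s)%:E | s in itv_partition 0%R T])%E.
      by apply: ereal_sup_ubound; exists l.
    rewrite fineK// fin_numElt Alty andbT.
    by rewrite (lt_le_trans _ lle)// ltNyr.
exists w; split => // s t s0 st tT.
apply: le_trans (entry_le_enorm _ i j) _.
by apply: powR_le_root => //; [exact: sqrtr_ge0|exact: wphi].
Qed.

End Variation.

(** * Sums along a partition up to time t *)

Section Clip.
Context {R : realType}.

Lemma partition_sum_nth {V : zmodType} (f : R -> R -> V) a s :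
  partition_sum f a s =
  \sum_(k < size s) f (nth 0 (a :: s) k) (nth 0 (a :: s) k.+1).
Proof.
elim: s a => [|b s IH] a; first by rewrite partition_sum_nil big_ord0.
by rewrite partition_sum_cons IH /= big_ord_recl.
Qed.

Lemma eq_partition_sum {V : zmodType} (f g : R -> R -> V) a s : path <=%R a s ->
  (forall u v, a <= u -> u <= v -> v <= last a s -> f u v = g u v) ->
  partition_sum f a s = partition_sum g a s.
Proof.
elim: s a => [|b s IH] a; first by rewrite !partition_sum_nil.
move=> /= /andP[ab bs] fg; rewrite !partition_sum_cons fg//; last first.
  by apply: (mem_last_path _ _ bs); exact: mem_head.
by rewrite (IH b bs)// => u v bu; apply: fg; exact: le_trans bu.
Qed.

Lemma partition_sum_map {V : zmodType} (g : R -> R) (f : R -> R -> V) a s :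
  partition_sum f (g a) (map g s) = partition_sum (fun u v => f (g u) (g v)) a s.
Proof.
elim: s a => [|b s IH] a /=; first by rewrite !partition_sum_nil.
by rewrite !partition_sum_cons IH.
Qed.

(* Left-point sums up to time [t] are partition sums over the clipped list; its
   repeated points contribute nothing. *)
Definition clip (t : R) (s : seq R) := map (Num.min^~ t) s.

Lemma min_homo (t : R) : {homo Num.min^~ t : x y / x <= y}.
Proof. by move=> x y xy; rewrite le_min !ge_min xy lexx orbT. Qed.

Lemma last_clip (t a : R) s : a <= t -> t <= last a s -> last a (clip t s) = t.
Proof.
move=> at_ ts; rewrite -{1}(min_idPl at_).
by rewrite (last_map (Num.min^~ t)) (min_idPr ts).
Qed.

Lemma path_fine_clip (delta t a : R) s : 0 < delta -> a <= t ->
  path (fine_step delta) a s -> path (fine_step delta) a (clip t s).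
Proof.
move=> d0 at_; rewrite -{2}(min_idPl at_); apply: homo_path => x y /andP[xy yx].
rewrite /fine_step /= min_homo//=.
by rewrite /Order.min; case: (ltP y t) => ?; case: (ltP x t) => ?; lra.
Qed.

Lemma clip_const {V : zmodType} (h : R -> R -> V) (t v : R) s :
  (forall x, h x x = 0) -> t <= v -> path <=%R v s ->
  partition_sum h t (clip t s) = 0.
Proof.
move=> h0; elim: s v => [|u s IH] v tv; first by rewrite partition_sum_nil.
move=> /= /andP[vu us]; rewrite partition_sum_cons.
by rewrite (min_idPr (le_trans tv vu)) h0 add0r (IH u)// (le_trans tv vu).
Qed.

Lemma clip_prefix {V : zmodType} (h : R -> R -> V) (a : R) s1 s2 :
  (forall x, h x x = 0) -> path <=%R a (s1 ++ s2) ->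
  partition_sum h a (clip (last a s1) (s1 ++ s2)) = partition_sum h a s1.
Proof.
move=> h0; elim: s1 a => [|b s1 IH] a.
  by move=> ps; rewrite /= partition_sum_nil (clip_const _ _ a).
move=> ps; have /= /andP[ab bs] := ps.
rewrite !partition_sum_cons (min_idPl _) ?IH//.
by apply: (mem_last_path b s1); [move: bs; rewrite cat_path => /andP[]|exact: mem_head].
Qed.

(** A clipped sum consists of complete steps and one incomplete step ending at [t]. The germ [h] is
    quantified after the splitting, so that several sums can be cut at the same point. *)
Lemma clip_split (t a : R) s : path <=%R a s -> a <= t -> t <= last a s ->
  exists s1 s2, [/\ s = s1 ++ s2, last a s1 <= t &
    forall h : R -> R -> R, (forall x, h x x = 0) ->
      partition_sum h a (clip t s) = partition_sum h a s1 + h (last a s1) t].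
Proof.
elim: s a => [|v s IH] a /=.
  move=> _ at_ ta; exists [::], [::]; split => // h h0.
  have -> : t = a by apply/le_anti; rewrite at_ ta.
  by rewrite partition_sum_nil /= h0 addr0.
move=> /andP[av vs] at_ ts; have [vt|tv] := leP v t.
  have [s1 [s2 [sE st H]]] := IH v vs vt ts.
  exists (v :: s1), s2; split => //=; first by rewrite sE.
  by move=> h h0; rewrite !partition_sum_cons H// addrA.
exists [::], (v :: s); split => //= h h0.
rewrite partition_sum_cons partition_sum_nil add0r.
by rewrite (clip_const _ _ v)// ?addr0// ltW.
Qed.

Lemma left_point_sum_clip {U V W : zmodType} (B : U -> V -> W) (P : nat -> seq R)
    (F : R -> U) (G : R -> V) n t : (forall x, B x 0 = 0) ->
  0 <= t -> path <=%R 0 (P n) ->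
  left_point_sum B P F G n t =
  partition_sum (fun u v => B (F u) (incr G u v)) 0 (clip t (P n)).
Proof.
move=> B0 t0 ps.
have -> : left_point_sum B P F G n t = partition_sum (fun u v =>
    B (F u) (incr G (Num.min u t) (Num.min v t))) 0 (P n).
  by rewrite partition_sum_nth.
rewrite -{2}(min_idPl t0) (partition_sum_map (Num.min^~ t)).
apply: eq_partition_sum => // u v _ uv _.
(* Beyond [t] the two sides evaluate [F] at different points, but both multiply it by a zero
   increment. *)
have [//|tu] := leP u t.
by rewrite (min_idPr (ltW (lt_le_trans tu uv))) /incr subrr !B0.
Qed.

End Clip.

(* The product sums are rewritten as [sum H_u (U_v - U_u)], a Young-type sum
   against the uniformly small path [U]; uniform smallness and the uniform
   variation bound are interpolated in the maximal inequality. *)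
Lemma young_sum_cvg0 {R : realType} (T alpha beta : R) (H : R -> R)
    (A w : R -> R -> R) (P : nat -> seq R)
    (U := fun n t => partition_sum A 0 (clip t (P n))) :
  0 <= T -> 0 < alpha -> 0 < beta -> 1 < alpha + beta ->
  holder T alpha (incr H) -> (forall x, A x x = 0) ->
  (forall n, path <=%R 0 (P n)) -> (forall n, last 0 (P n) = T) ->
  (forall e, 0 < e -> \forall n \near \oo,
     forall t, 0 <= t <= T -> `|U n t| <= e) ->
  control T w ->
  (forall n u v, u \in 0 :: P n -> v \in 0 :: P n -> u <= v ->
     `|U n v - U n u| <= w u v `^ beta) ->
  forall e, 0 < e -> \forall n \near \oo, forall t, 0 <= t <= T ->
    `|partition_sum (fun u v => H u * A u v) 0 (clip t (P n))| <= e.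
Proof.
move=> T0 a0 b0 ab1 hH Axx pP lP Usmall wc wU e e0.
have [M M0 HM] := holder_bounded _ _ _ (ltW a0) hH.
have [wH [wHc hwH]] := hH.
pose N := `|H 0| + M; have N0 : 0 < N by rewrite ltr_wpDl.
have HN t : 0 <= t -> t <= T -> `|H t| <= N.
  move=> t0 tT; have -> : H t = H 0 + incr H 0 t by rewrite /incr; ring.
  by apply: le_trans (ler_normD _ _) _; rewrite lerD2l HM.
set eta := alpha + beta in ab1; pose theta := (1 + eta) / 2.
pose mu := 1 - (1 + eta) / 2 / eta.
have eta0 : 0 < eta by rewrite addr_gt0.
have mu0 : 0 < mu by rewrite subr_gt0 ltr_pdivrMr// mul1r; lra.
have th1 : 1 < theta by rewrite /theta; lra.
pose w' s t := wH s t + w s t.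
have wc' : control T w' by exact: controlD.
have [w'0 w'D] := wc'.
pose W := w' 0 T; have W0 : 0 <= W by exact: w'0.
have C0 := ltW (sewing_const_gt0 _ th1).
pose Q := sewing_const theta * W `^ theta.
have Q0 : 0 <= Q by rewrite mulr_ge0 ?powR_ge0.
pose kappa := e / 2 / (Q + 1).
have Q10 : 0 < Q + 1 by rewrite ltr_wpDl.
have k0 : 0 < kappa by rewrite !divr_gt0.
(* If [U n] is bounded by [d1], a defect is at most [M * (2 * d1)], whose power [mu] is [kappa]. *)
pose d1 := kappa `^ mu^-1 / (M * 2).
have M20 : 0 < M * 2 by rewrite mulr_gt0.
have d10 : 0 < d1 by rewrite divr_gt0// powR_gt0.
(* Three units of [N * d2]: one for the one-interval approximation [X 0 v], two for the incomplete
   last step. *)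
pose d2 := e / 2 / (N * 3).
have N30 : 0 < N * 3 by rewrite mulr_gt0.
have d20 : 0 < d2 by rewrite !divr_gt0.
pose d := Num.min d1 d2; have d0 : 0 < d by rewrite lt_min d10.
apply: filterS (Usmall d d0) => n Ud t /andP[t0 tT].
have [|s1 [s2 [sE st clipE]]] := clip_split t 0 (P n) (pP n) t0.
  by rewrite lP.
rewrite clipE; last by move=> x; rewrite Axx mulr0.
have Tin x : x \in 0 :: P n -> 0 <= x <= T.
  move=> xP; rewrite (mem_head_path _ _ (pP n) _ xP).
  by rewrite -(lP n) (mem_last_path _ _ (pP n) _ xP).
have Upre r1 r2 : P n = r1 ++ r2 -> U n (last 0 r1) = partition_sum A 0 r1.
  by move=> rE; rewrite /U rE clip_prefix// -rE.
have sumE : partition_sum (fun u v => H u * A u v) 0 s1 =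
    partition_sum (fun u v => H u * (U n v - U n u)) 0 s1.
  move: (s1) (s2) sE => r1; elim/last_ind: r1 => [|r x IH] r2 rE.
    by rewrite !partition_sum_nil.
  rewrite -cats1 !partition_sum_cat (IH (x :: r2)) -?cat_rcons//.
  rewrite !partition_sum_cons !partition_sum_nil !addr0.
  have := Upre _ _ rE; rewrite last_rcons => ->.
  rewrite (Upre r (x :: r2)) -?cat_rcons//.
  by rewrite -cats1 partition_sum_cat partition_sum_cons partition_sum_nil; ring.
set v := last 0 s1 in st clipE *.
have vP : v \in 0 :: P n by rewrite sE -cat_cons mem_cat /v mem_last.
have /andP[v0 vT] := Tin _ vP.
have lastE : A v t = U n t - U n v.
  by rewrite (Upre s1 s2 sE) /U clipE//; ring.
have U0 : U n 0 = 0 by rewrite (Upre [::] (P n))// partition_sum_nil.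
have ps1 : path <=%R 0 s1 by have := pP n; rewrite sE cat_path => /andP[].
pose X u v := H u * (U n v - U n u).
have XD x y z : x \in 0 :: P n -> y \in 0 :: P n -> z \in 0 :: P n ->
    x <= y -> y <= z -> `|X x z - X x y - X y z| <= kappa * w' x z `^ theta.
  move=> xP yP zP xy yz.
  have /andP[x0 xT] := Tin _ xP; have /andP[y0 yT] := Tin _ yP.
  have /andP[z0 zT] := Tin _ zP; have [wH0 _] := wHc; have [w0 _] := wc.
  (* Since [U n] is additive, the defect is a single product: the variation bounds give it total
     exponent [eta], the smallness of [U n] makes it small. *)
  have -> : X x z - X x y - X y z = - (incr H x y * (U n z - U n y)).
    by rewrite /X /incr; ring.
  rewrite normrN.
  have Uzy : `|U n z - U n y| <= 2 * d.
    apply: le_trans (ler_normB _ _) _.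
    by have := Ud z; have := Ud y; rewrite y0 yT z0 zT => /(_ isT) ? /(_ isT) ?; lra.
  have small : `|incr H x y * (U n z - U n y)| <= M * (2 * d).
    by rewrite normrM; apply: ler_pM => //; exact: HM.
  have w'le u1 u2 : x <= u1 -> u1 <= u2 -> u2 <= z -> w' u1 u2 <= w' x z.
    by move=> ? ? ?; exact: (control_le T).
  have big : `|incr H x y * (U n z - U n y)| <= w' x z `^ eta.
    rewrite normrM powRD; last by apply/implyP; rewrite gt_eqF.
    have wxy := wH0 x y x0 xy yT; have wyz := w0 y z y0 yz zT.
    have wxy' := w0 x y x0 xy yT; have wyz' := wH0 y z y0 yz zT.
    have j1 : wH x y <= w' x z.
      by apply: le_trans (w'le _ _ (lexx _) xy yz); rewrite lerDl.
    have j2 : w y z <= w' x z.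
      by apply: le_trans (w'le _ _ xy yz (lexx _)); rewrite lerDr.
    apply: ler_pM => //.
      apply: le_trans (hwH _ _ x0 xy yT) _.
      apply: ge0_ler_powR; rewrite ?nnegrE ?(ltW a0)//; exact: le_trans j1.
    apply: le_trans (wU _ _ _ yP zP yz) _.
    apply: ge0_ler_powR; rewrite ?nnegrE ?(ltW b0)//; exact: le_trans j2.
  have sm0 : 0 <= M * (2 * d) by rewrite !mulr_ge0// ltW.
  have wxz : 0 <= w' x z by apply: w'0 => //; exact: le_trans yz.
  apply: le_trans (geometric_interpolation eta _ _ _ ab1 sm0 wxz (normr_ge0 _) small big) _.
  apply: ler_wpM2r; first exact: powR_ge0.
  rewrite -/mu; apply: le_trans (_ : _ <= (kappa `^ mu^-1) `^ mu) _; last first.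
    by rewrite -powRrM mulVf ?gt_eqF// powRr1 // ltW.
  apply: ge0_ler_powR; rewrite ?nnegrE ?powR_ge0//; first exact: ltW.
  by rewrite mulrA mulrC -ler_pdivlMr// ge_min lexx.
have sm := sewing_maximal [set x | x \in 0 :: P n] X w' kappa theta th1 (ltW k0).
have {}sm : `|X 0 v - partition_sum X 0 s1| <=
    kappa * sewing_const theta * w' 0 v `^ theta.
  apply: sm => //.
  - by move=> x _; rewrite /X subrr mulr0.
  - move=> x y /= /Tin/andP[x0 _] /Tin/andP[_ yT] xy; exact: w'0.
  - move=> x y z /= /Tin/andP[x0 _] _ /Tin/andP[_ zT] xy yz; exact: w'D.
  - by move=> x xs /=; rewrite sE -cat_cons mem_cat xs.
rewrite sumE lastE -/X.
have Xb : `|X 0 v| <= N * d.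
  rewrite /X U0 subr0 normrM; apply: ler_pM => //; first exact: HN.
  by apply: Ud; rewrite v0 vT.
have lastb : `|H v * (U n t - U n v)| <= N * (2 * d).
  rewrite normrM; apply: ler_pM => //; first exact: HN.
  apply: le_trans (ler_normB _ _) _.
  by have := Ud t; have := Ud v; rewrite v0 vT t0 tT => /(_ isT) ? /(_ isT) ?; lra.
have smb : kappa * sewing_const theta * w' 0 v `^ theta <= e / 2.
  apply: le_trans (_ : _ <= kappa * Q) _.
    rewrite -mulrA; apply: ler_wpM2l; first exact: ltW.
    apply: ler_wpM2l => //; apply: ge0_ler_powR; rewrite ?nnegrE ?w'0//; first lra.
    exact: (control_le T).
  by rewrite /kappa mulrAC ler_pdivrMr// ler_pM2l ?divr_gt0// ler_wpDr.
have db : N * d + N * (2 * d) <= e / 2.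
  have -> : N * d + N * (2 * d) = d * (N * 3) by ring.
  by rewrite -ler_pdivlMr// ge_min lexx orbT.
have -> : partition_sum X 0 s1 + H v * (U n t - U n v) =
  X 0 v - (X 0 v - partition_sum X 0 s1) + H v * (U n t - U n v) by ring.
apply: le_trans (ler_normD _ _) _.
have := ler_normB (X 0 v) (X 0 v - partition_sum X 0 s1); lra.
Qed.

(** * Property (RIE) *)

Section RIE.
Context {R : realType}.

Lemma equot_ge0 (x y : R) : 0 <= x -> 0 <= y -> (0 <= equot x y)%E.
Proof.
move=> x0 y0; rewrite /equot mule_ge0 ?lee_fin// inver.
by case: ifPn => // _; rewrite lee_fin invr_ge0.
Qed.

Lemma equot_le1 (x y : R) : 0 <= x -> 0 <= y -> (equot x y <= 1)%E -> x <= y.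
Proof.
move=> x0 y0; rewrite /equot inver; case: ifPn => [/eqP->|yn0].
  move: x0; rewrite le_eqVlt => /orP[/eqP<- //|xp].
  by rewrite gt0_muley ?lte_fin.
by rewrite -EFinM lee_fin ler_pdivrMr ?mul1r// lt_neqAle eq_sym yn0.
Qed.

Lemma ppt_itv {T : R} {P : nat -> seq R} n k : itv_partition 0 T (P n) ->
  (k <= size (P n))%N -> 0 <= ppt P n k <= T.
Proof.
move=> [pP /eqP lP] ks.
have pP' : path <=%R 0 (P n) by apply: sub_path pP => x y /ltW.
have kP : ppt P n k \in 0 :: P n by apply: mem_nth.
by rewrite (mem_head_path _ _ pP' _ kP) -lP (mem_last_path _ _ pP' _ kP).
Qed.

Lemma ppt_lt {T : R} {P : nat -> seq R} n k l : itv_partition 0 T (P n) ->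
  (k < l <= size (P n))%N -> ppt P n k < ppt P n l.
Proof.
move=> [pP _] /andP[kl ls]; rewrite /ppt.
apply: (@sorted_ltn_nth _ (fun x y => x < y)) => //; first exact: lt_trans.
by rewrite inE /= ltnS (leq_trans (ltnW kl)).
Qed.

Lemma mem_ppt_lt {T : R} {P : nat -> seq R} n u v : itv_partition 0 T (P n) ->
  u \in 0 :: P n -> v \in 0 :: P n -> u < v ->
  exists k l, [/\ u = ppt P n k, v = ppt P n l & (k < l <= size (P n))%N].
Proof.
move=> iP uP vP uv; exists (index u (0 :: P n)), (index v (0 :: P n)).
rewrite /ppt !nth_index//; split => //.
have := vP; rewrite -index_mem ltnS => ->; rewrite andbT ltnNge; apply/negP => lk.
have us := uP; rewrite -index_mem ltnS in us.
move: lk; rewrite leq_eqVlt => /orP[/eqP lk|lk].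
  by move: uv; rewrite -(nth_index 0 uP) -lk nth_index// ltxx.
have := ppt_lt n _ _ iP (introT andP (conj lk us)).
by rewrite /ppt !nth_index// => /(lt_trans uv); rewrite ltxx.
Qed.

Definition step_area {d} (P : nat -> seq R) (S : R -> 'cV[R]_d) n u v : 'M[R]_d :=
  incr (step_integral P S n) u v - tensor (S u) (incr S u v).

(** To bound each of two suprema by their sum, both must be nonnegative, hence taken over nonempty
    sets; [0 < T] provides a first interval in [P 0]. *)
Lemma RIE_boundE {d} (T p : R) (P : nat -> seq R) (S : R -> 'cV[R]_d) w :
  0 < T -> (forall n, itv_partition 0 T (P n)) -> control T w ->
  RIE_bound T p P S w ->
  (forall s t, 0 <= s -> s <= t -> t <= T -> enorm (incr S s t) `^ p <= w s t) /\
  (forall n u v, u \in 0 :: P n -> v \in 0 :: P n -> u < v ->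
     enorm (step_area P S n u v) `^ (p / 2) <= w u v).
Proof.
move=> T0 iP [w0 wD]; rewrite /RIE_bound.
set X := ereal_sup _; set Y := ereal_sup _ => XY.
have size0 : (0 < size (P 0%N))%N.
  case E : (P 0%N) => [|//]; have := iP 0%N; rewrite E => /itv_partition_nil.
  by move=> T0'; move: T0; rewrite -T0' ltxx.
have X0 : (0 <= X)%E.
  have w00 : 0 <= w 0 0 by apply: w0 => //; exact: ltW.
  apply: le_trans (equot_ge0 _ _ (powR_ge0 (enorm (incr S 0 0)) p) w00) _.
  by apply: ereal_sup_ubound; exists (0, 0) => //=; split => //; split => //; exact: ltW.
have pw n k l : (k < l <= size (P n))%N -> 0 <= w (ppt P n k) (ppt P n l).
  move=> kl; have /andP[kl' ls] := kl.
  have /andP[k0 _] := ppt_itv n k (iP n) (leq_trans (ltnW kl') ls).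
  have /andP[_ lT] := ppt_itv n l (iP n) ls.
  by apply: w0 => //; exact: ltW (ppt_lt n k l (iP n) kl).
have Yb n k l : (k < l <= size (P n))%N ->
    (equot (enorm (step_area P S n (ppt P n k) (ppt P n l)) `^ (p / 2))
       (w (ppt P n k) (ppt P n l)) <= Y)%E.
  move=> kl; apply: le_trans; last by apply: ereal_sup_ubound; exists n.
  by apply: ereal_sup_ubound; exists (k, l).
have Y0 : (0 <= Y)%E.
  apply: le_trans (Yb 0%N 0%N 1%N _); last by rewrite size0.
  by apply: equot_ge0; [exact: powR_ge0|apply: pw; rewrite size0].
have X1 : (X <= 1)%E by apply: le_trans XY; exact: leeDl.
have Y1 : (Y <= 1)%E by apply: le_trans XY; exact: leeDr.
split=> [s t s0 st tT|n u v uP vP uv].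
  apply: equot_le1; [exact: powR_ge0|exact: w0|apply: le_trans X1].
  by apply: ereal_sup_ubound; exists (s, t).
have [k [l [-> -> kl]]] := mem_ppt_lt n u v (iP n) uP vP uv.
apply: equot_le1; [exact: powR_ge0|exact: pw|apply: le_trans Y1; exact: Yb].
Qed.

Lemma mx_entry_le_norm {m n} (x : 'M[R]_(m, n)) i j : `|x i j| <= `|x|.
Proof.
have -> : `|x| = \big[Num.max/0]_ij `|x ij.1 ij.2| by exact: mx_normrE.
exact: (le_bigmax _ (fun ij : 'I_m * 'I_n => `|x ij.1 ij.2|) (i, j)).
Qed.

Lemma mesh_ge (a : R) s s1 s2 u v : a :: s = s1 ++ [:: u, v & s2] -> v - u <= mesh a s.
Proof.
move=> sE; rewrite /mesh.
have : (u, v) \in zip (a :: s) s.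
  elim: s1 a s sE => [|x s1 IH] a s /= [].
    by move=> <- ->; rewrite /= mem_head.
  move=> -> sE; case: s sE => [|y s] sE; first by case: (s1) sE.
  by rewrite /= inE -/(zip _ _) (IH y s sE) orbT.
by move=> uvz; exact: (Order.TotalTheory.le_bigmax_seq 0 (u, v) xpredT (fun uv : R * R => uv.2 - uv.1)).
Qed.

Lemma mesh_fine (delta a : R) s : mesh a s < delta -> path <=%R a s ->
  path (fine_step delta) a s.
Proof.
elim: s a => [//|b s IH] a; rewrite /mesh /= big_cons gt_max => /andP[h1 h2].
by move=> /andP[ab bs]; rewrite /fine_step ab /= h1 IH.
Qed.

(** Rounding goes upwards because values at points approaching [x] from the right converge to the
    value at [x]; from the left they would give left limits. The default of [nth] is not reached for
    [x <= T]. *)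
Definition round_up (P : seq R) (x : R) : R :=
  nth 0 (0 :: P) (find (fun y => x <= y) (0 :: P)).

Lemma round_up_mem (T : R) P x : itv_partition 0 T P -> 0 <= x <= T ->
  [/\ round_up P x \in 0 :: P, x <= round_up P x & round_up P x - x <= mesh 0 P].
Proof.
move=> [pP /eqP lP] /andP[x0 xT].
have h : has (fun y => x <= y) (0 :: P).
  by apply/hasP; exists T => //; rewrite -lP mem_last.
rewrite /round_up; split; first by rewrite mem_nth// -has_find.
  exact: nth_find.
have mesh0 : 0 <= mesh 0 P by exact: bigmax_ge_id.
case E : (find _ _) => [|k]; first by rewrite /= sub0r; lra.
have kP : (k.+1 < size (0%R :: P))%N by rewrite -E -has_find.
have lk : nth 0 (0 :: P) k < x.
  by rewrite ltNge; apply/negbT; apply: (@before_find _ 0 (fun y => x <= y)); rewrite E.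
apply: le_trans (_ : _ <= nth 0 (0 :: P) k.+1 - nth 0 (0 :: P) k) _; first by lra.
apply: (mesh_ge 0 P (take k ((0:R) :: P)) (drop k.+2 ((0:R) :: P))).
by rewrite -!drop_nth ?cat_take_drop// ltnW.
Qed.

Lemma round_up_homo (T : R) P x y : itv_partition 0 T P -> x <= y -> y <= T ->
  round_up P x <= round_up P y.
Proof.
move=> [pP /eqP lP] xy yT; rewrite /round_up.
have h z : z <= T -> (find (fun y => (z <= y)%R) (0%R :: P) < size (0%R :: P))%N.
  by move=> zT; rewrite -has_find; apply/hasP; exists T => //; rewrite -lP mem_last.
apply: (@sorted_leq_nth _ <=%R) => //.
- exact: le_trans.
- by apply: sub_path pP => ? ? /ltW.
- by rewrite inE h// (le_trans xy).
- by rewrite inE h.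
- by apply: sub_find => z /=; exact: le_trans.
Qed.

End RIE.

(** * Variation and jumps of the area *)

Section Area.
Context {R : realType} {d : nat}.

Lemma partition_sum_entry {m n} (f : R -> R -> 'M[R]_(m, n)) x s i j :
  partition_sum f x s i j = partition_sum (fun u v => f u v i j) x s.
Proof.
elim: s x => [|y s IH] x; first by rewrite !partition_sum_nil mxE.
by rewrite !partition_sum_cons mxE IH.
Qed.

Lemma control_sum_le (T : R) (w phi : R -> R -> R) (rho : R -> R) s x :
  control T w -> 0 <= x -> path <=%R x s -> last x s <= T ->
  (forall u, 0 <= u <= T -> 0 <= rho u <= T) ->
  (forall u v, 0 <= u -> u <= v -> v <= T ->
     rho u <= rho v /\ phi (rho u) (rho v) <= w (rho u) (rho v)) ->
  partition_sum (fun u v => phi (rho u) (rho v)) x s <= w (rho x) (rho (last x s)).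
Proof.
move=> [w0 wD] + + + rT h; elim: s x => [|y s IH] x x0 /=.
  by move=> _ xT; rewrite partition_sum_nil w0 //; have /andP[] := rT x (introT andP (conj x0 xT)).
move=> /andP[xy ys] sT; rewrite partition_sum_cons.
have y0 := le_trans x0 xy.
have yl : y <= last y s by apply: (mem_last_path _ _ ys); exact: mem_head.
have yT := le_trans yl sT.
have [r1 r2] := h x y x0 xy yT; have [r3 _] := h y (last y s) y0 yl sT.
have /andP[rx0 _] := rT x (introT andP (conj x0 (le_trans xy yT))).
have /andP[_ rlT] := rT (last y s) (introT andP (conj (le_trans y0 yl) sT)).
apply: le_trans (wD _ _ _ rx0 r1 r3 rlT).
by apply: lerD => //; exact: IH.
Qed.

Lemma powR_add_le (x y s : R) : 0 <= x -> 0 <= y -> 0 <= s ->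
  (x + y) `^ s <= 2 `^ s * (x `^ s + y `^ s).
Proof.
move=> x0 y0 s0; wlog xy : x y x0 y0 / y <= x => [hw|].
  by case: (leP y x) => [/hw|/ltW /hw]; [exact|rewrite (addrC y) (addrC (y `^ s)); exact].
apply: le_trans (_ : _ <= (2 * x) `^ s) _.
  by apply: ge0_ler_powR; rewrite ?nnegrE ?addr_ge0 ?mulr_ge0//; lra.
by rewrite powRM// ler_wpM2l ?powR_ge0// lerDl powR_ge0.
Qed.

(** Lower semicontinuity of variation sums under pointwise convergence, up to the factor [2^s] from
    [powR_add_le]. The factor is harmless, since only finiteness of the variation is at stake. *)
Lemma powR_sum_near (T s : R) (A : R -> R -> R) (rho : nat -> R -> R)
    (phi := fun u v => `|A u v| `^ s) : 0 < s ->
  (forall u v, 0 <= u <= T -> 0 <= v <= T ->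
     A (rho n u) (rho n v) @[n --> \oo] --> A u v) ->
  forall l x, 0 <= x -> path <=%R x l -> last x l <= T -> forall e, 0 < e ->
  \forall n \near \oo, partition_sum phi x l <= 2 `^ s *
    (partition_sum (fun u v => phi (rho n u) (rho n v)) x l + e).
Proof.
move=> s0 rhoc l x.
  elim: l x => [|y l IH] x x0 /=.
    move=> _ _ e e0; apply: filterE => n; rewrite !partition_sum_nil add0r.
    by apply: mulr_ge0; [exact: powR_ge0|exact: ltW].
  move=> /andP[xy yl] lT e e0; have e20 : 0 < e / 2 by rewrite divr_gt0.
  have y0 := le_trans x0 xy.
  have yT : y <= T.
    by apply: le_trans lT; apply: (mem_last_path _ _ yl); exact: mem_head.
  have rt0 : 0 < (e / 2) `^ s^-1 by rewrite powR_gt0.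
  have xin : 0 <= x <= T by rewrite x0 (le_trans xy).
  have yin : 0 <= y <= T by rewrite y0.
  have /cvgrPdist_le/(_ _ rt0) cA := rhoc x y xin yin.
  apply: filterS2 cA (IH y y0 yl lT _ e20) => n h1 h2.
  rewrite !partition_sum_cons.
  set rx := rho n x; set ry := rho n y; rewrite -/rx -/ry in h1.
  have h3 : phi x y <= 2 `^ s * (phi rx ry + e / 2).
    apply: le_trans (_ : _ <= (`|A rx ry| + (e / 2) `^ s^-1) `^ s) _.
      apply: ge0_ler_powR; rewrite ?nnegrE ?addr_ge0 ?powR_ge0// ?(ltW s0)//.
      have -> : A x y = A rx ry + (A x y - A rx ry) by ring.
      by apply: le_trans (ler_normD _ _) _; rewrite lerD2l.
    apply: le_trans (powR_add_le _ _ _ (normr_ge0 _) (ltW rt0) (ltW s0)) _.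
    by rewrite -powRrM mulVf ?gt_eqF// powRr1 ?(ltW e20).
  have -> : 2 `^ s * (phi rx ry + partition_sum (fun u v =>
      phi (rho n u) (rho n v)) y l + e) =
    2 `^ s * (phi rx ry + e / 2) + 2 `^ s * (partition_sum (fun u v =>
      phi (rho n u) (rho n v)) y l + e / 2) by field.
  exact: lerD.
Qed.

Context (T p : R) (P : nat -> seq R) (S : R -> 'cV[R]_d) (w : R -> R -> R).
Context (T0 : 0 < T) (p0 : 0 < p) (hS : cadlag 0 T S)
  (hP : nested_partitions T P) (wc : control T w) (hw : RIE_bound T p P S w)
  (I : R -> 'M[R]_d)
  (hI : {uniform [set` `[0, T]], step_integral P S n @[n --> \oo] --> I}).
Context (a b : 'I_d).

Let A u v := area P S u v a b.
Let I' t := RIE_integral P S t a b.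
Let sa u := S u a ord0.
Let sb u := S u b ord0.
Let st n t := step_integral P S n t a b.

Let iP n : itv_partition 0 T (P n). Proof. by case: hP. Qed.
Let pP n : path <=%R 0 (P n).
Proof. by have [+ _] := iP n; apply: sub_path => x y /ltW. Qed.
Let lP n : last 0 (P n) = T. Proof. by have [_ /eqP] := iP n. Qed.
Let Tin n u : u \in 0 :: P n -> 0 <= u <= T.
Proof.
move=> uP; rewrite (mem_head_path _ _ (pP n) _ uP).
by rewrite -(lP n) (mem_last_path _ _ (pP n) _ uP).
Qed.

Lemma step_integral_unif e : 0 < e -> \forall n \near \oo,
  forall t, 0 <= t <= T -> `|I' t - st n t| <= e.
Proof.
move=> e0; have /uniform_cvgP H := hI.
have IE t : 0 <= t <= T -> RIE_integral P S t = I t.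
  move=> tT; apply/cvg_lim => //; apply/cvgrPdist_lt => e' e'0.
  by apply: filterS (H e' e'0) => n; apply; rewrite /= in_itv.
apply: filterS (H e e0) => n Hn t tT; rewrite /I' IE//.
have := mx_entry_le_norm (I t - step_integral P S n t) a b.
rewrite !mxE => h; apply: le_trans h _.
by apply/ltW/Hn; rewrite /= in_itv.
Qed.

Lemma step_integral_entry n t : 0 <= t ->
  st n t = partition_sum (fun u v => sa u * (sb v - sb u)) 0 (clip t (P n)).
Proof.
move=> t0; rewrite /st /step_integral left_point_sum_clip//; last first.
  by move=> x; rewrite /tensor trmx0 mulmx0.
rewrite partition_sum_entry; congr partition_sum.
by apply/funext => u; apply/funext => v; rewrite tensorE !mxE.
Qed.

Lemma area_entry u v : A u v = I' v - I' u - sa u * (sb v - sb u).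
Proof. by rewrite /A /area !mxE big_ord1 !mxE. Qed.

Lemma area_refl u : A u u = 0.
Proof. by rewrite area_entry !subrr mulr0 subrr. Qed.

Lemma area_chen s u t : A s t = A s u + A u t + (sa u - sa s) * (sb t - sb u).
Proof. by rewrite !area_entry; ring. Qed.

Let oscS i : small_osc T (incr (fun u => S u i ord0)).
Proof. by apply: cadlag_small_osc; [exact: ltW|exact: cadlag_entry hS]. Qed.

(** For fixed [n] this is a finite linear combination of paths of [S] stopped at partition points.
    Uniform convergence then transfers the property to the limit integral. *)
Lemma step_integral_osc n : small_osc T (incr (st n)).
Proof.
have H (k : 'I_(size (P n))) : small_osc T (fun x y => sa (ppt P n k) *
    (incr (fun t => sb (Num.min (ppt P n k.+1) t)) x y -
     incr (fun t => sb (Num.min (ppt P n k) t)) x y)).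
  apply: (small_osc_weight T (fun _ _ => sa (ppt P n k)) _ `|sa (ppt P n k)|) => //.
  apply: small_oscD.
    by apply: small_osc_min (oscS b); have /andP[] := ppt_itv n k.+1 (iP n) (ltn_ord k).
  apply: (small_osc_le _ _ (incr (fun t => sb (Num.min (ppt P n k) t)))).
    by apply: small_osc_min (oscS b); have /andP[] := ppt_itv n k (iP n) (ltnW (ltn_ord k)).
  by move=> *; rewrite normrN.
apply: (small_osc_le _ _ _ (small_osc_sum T _ (index_enum _) _ H)) => x y _ _ _.
rewrite /st /incr /step_integral /left_point_sum !summxE -sumrB.
rewrite (eq_bigr (fun k : 'I_(size (P n)) => sa (ppt P n k) *
  (sb (Num.min (ppt P n k.+1) y) - sb (Num.min (ppt P n k.+1) x) -
  (sb (Num.min (ppt P n k) y) - sb (Num.min (ppt P n k) x))))) // => k _.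
by rewrite !tensorE !mxE /sa /sb; ring.
Qed.

Lemma RIE_integral_osc : small_osc T (incr I').
Proof.
apply: small_osc_limit => e e0; have e20 : 0 < e / 2 by rewrite divr_gt0.
have [n Hn] := filter_ex (step_integral_unif _ e20).
exists (incr (st n)); first exact: step_integral_osc.
move=> s t s0 sst tT.
have h1 := Hn s; have h2 := Hn t.
rewrite s0 (le_trans sst tT) in h1; rewrite tT (le_trans s0 sst) in h2.
have -> : incr I' s t - incr (st n) s t = (I' t - st n t) - (I' s - st n s).
  by rewrite /incr; ring.
by apply: le_trans (ler_normB _ _) _; have := h1 isT; have := h2 isT; lra.
Qed.

Let bounds := RIE_boundE T p P S w T0 iP wc hw.

Lemma RIE_path_holder i : holder T p^-1 (incr (fun u => S u i ord0)).
Proof.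
exists w; split => // s t s0 sst tT.
apply: powR_le_root => //; have [h _] := bounds.
apply: le_trans (h s t s0 sst tT).
apply: ge0_ler_powR; rewrite ?nnegrE ?sqrtr_ge0//; first exact: ltW.
by apply: le_trans (entry_le_enorm _ i ord0); rewrite /incr !mxE.
Qed.

Lemma area_osc : small_osc T A.
Proof.
have p1 : 0 <= p^-1 by rewrite invr_ge0 ltW.
have [M M0 HM] := holder_bounded _ _ _ p1 (RIE_path_holder a).
apply: (small_osc_le _ _ (fun u v => incr I' u v + (- sa u) * incr sb u v)).
  apply: small_oscD; first exact: RIE_integral_osc.
  apply: (small_osc_weight T (fun u _ => - sa u) _ (`|sa 0| + M)); last exact: oscS.
  move=> s t s0 sst tT; rewrite normrN.
  have -> : sa s = sa 0 + incr sa 0 s by rewrite /incr; ring.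
  apply: le_trans (ler_normD _ _) _; rewrite lerD2l.
  by apply: HM => //; rewrite (le_trans sst).
by move=> s t _ _ _; rewrite area_entry /incr mulNr.
Qed.

Lemma step_area_point n u v : u \in 0 :: P n -> v \in 0 :: P n -> u <= v ->
  `|st n v - st n u - sa u * (sb v - sb u)| <= w u v `^ (p / 2)^-1.
Proof.
move=> uP vP; rewrite le_eqVlt => /orP[/eqP<-|uv].
  by rewrite !subrr mulr0 subrr normr0 powR_ge0.
apply: powR_le_root => //; first by rewrite divr_gt0.
have [_ h] := bounds; apply: le_trans (h n u v uP vP uv).
apply: ge0_ler_powR; rewrite ?nnegrE ?sqrtr_ge0//; first by rewrite ltW// divr_gt0.
apply: le_trans (entry_le_enorm _ a b).
by rewrite /step_area /incr !mxE big_ord1 !mxE.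
Qed.

Let nested n m : (n <= m)%N -> {subset 0 :: P n <= 0 :: P m}.
Proof.
have [_ sub _] := hP; move=> /subnK <-; elim: (m - n)%N => [|k IH] x //= xP.
by apply: sub; exact: IH.
Qed.

(** By nestedness [u] and [v] belong to all later partitions, so the (RIE) bound for the [m]-th area
    holds at them for every [m >= n] and passes to the limit. *)
Lemma area_point n u v : u \in 0 :: P n -> v \in 0 :: P n -> u <= v ->
  `|A u v| <= w u v `^ (p / 2)^-1.
Proof.
move=> uP vP uv; apply/ler_addgt0Pr => e e0.
have e20 : 0 < e / 2 by rewrite divr_gt0.
near \oo => m.
have nm : (n <= m)%N by near: m; exact: nbhs_infty_ge.
have Hm : forall t, 0 <= t <= T -> `|I' t - st m t| <= e / 2.
  by near: m; exact: step_integral_unif.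
have h1 := Hm u (Tin _ _ uP); have h2 := Hm v (Tin _ _ vP).
have h3 := step_area_point m u v (nested _ _ nm _ uP) (nested _ _ nm _ vP) uv.
have -> : A u v = (st m v - st m u - sa u * (sb v - sb u)) +
  ((I' v - st m v) - (I' u - st m u)) by rewrite area_entry; ring.
apply: le_trans (ler_normD _ _) _; apply: lerD => //.
by apply: le_trans (ler_normB _ _) _; lra.
Unshelve. all: by end_near. Qed.

Lemma round_up_cvg x : 0 <= x <= T -> round_up (P n) x @[n --> \oo] --> x.
Proof.
move=> xT; have [_ _ /cvgrPdist_lt meshc] := hP.
apply/cvgrPdist_lt => e e0; apply: filterS (meshc e e0) => n.
rewrite sub0r normrN => h; have [_ xr rm] := round_up_mem T _ x (iP n) xT.
rewrite distrC ger0_norm ?subr_ge0//; apply: le_lt_trans rm _.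
exact: le_lt_trans (ler_norm _) h.
Qed.

Let round_upT n x : 0 <= x <= T -> x <= round_up (P n) x <= T.
Proof.
by move=> xT; have [/Tin/andP[_ ->] -> _] := round_up_mem T _ x (iP n) xT.
Qed.

Lemma area_round_up_cvg u v : 0 <= u <= T -> 0 <= v <= T ->
  A (round_up (P n) u) (round_up (P n) v) @[n --> \oo] --> A u v.
Proof.
move=> uT vT; have [/andP[u0 _] /andP[v0 _]] := (uT, vT).
have c f x : small_osc T (incr f) -> 0 <= x <= T ->
    f (round_up (P n) x) @[n --> \oo] --> f x.
  move=> of_ xT; apply: (small_osc_right_cvg T) => //.
  - by case/andP: xT.
  - by move=> n; exact: round_upT.
  - exact: round_up_cvg.
rewrite area_entry; under eq_cvg do rewrite area_entry.
have cI := RIE_integral_osc; have ca := oscS a; have cb := oscS b.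
apply: cvgB; first by apply: cvgB; apply: c.
by apply: cvgM; [exact: (c sa)|apply: cvgB; apply: (c sb)].
Qed.

(** The bound [w] at rounded points cannot be compared with [w] at the original ones, as [w] need
    not be right-continuous. Its sums along a whole partition are still at most [w 0 T], and this
    bound on the variation yields a new control. *)
Lemma area_holder : holder T (p / 2)^-1 A.
Proof.
set s := p / 2; have s0 : 0 < s by rewrite divr_gt0.
pose phi u v := `|A u v| `^ s.
have [w' [wc' hw']] : exists w', control T w' /\
    forall s t, 0 <= s -> s <= t -> t <= T -> phi s t <= w' s t.
  (* [2^s] and the slack [1] come from [powR_sum_near] with [e = 1]. *)
  apply: (bounded_sums_control T phi (2 `^ s * (w 0 T + 1))) => //.
  - by move=> *; exact: powR_ge0.
  - by move=> u; rewrite /phi area_refl normr0 powR0// gt_eqF.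
  - move=> l [pl /eqP ll].
    have pl' : path <=%R 0 l by apply: sub_path pl => x y /ltW.
    have lT : last 0 l <= T by rewrite ll.
    have [n Hn] := filter_ex (powR_sum_near T s A (fun n => round_up (P n)) s0 area_round_up_cvg l 0 (lexx _) pl' lT 1 ltr01).
    apply: le_trans Hn _; rewrite ler_wpM2l ?powR_ge0// lerD2r.
    apply: le_trans (control_sum_le T w phi (round_up (P n)) l 0 wc (lexx _) pl' lT _ _) _.
    + move=> u uT; have /andP[h ->] := round_upT n u uT.
      by case/andP: uT => u0 _; rewrite (le_trans u0 h).
    + move=> u v u0 uv vT; have uin : 0 <= u <= T by rewrite u0 (le_trans uv).
      have vin : 0 <= v <= T by rewrite vT (le_trans u0).
      have ruv := round_up_homo T _ u v (iP n) uv vT; split => //.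
      have [ru _ _] := round_up_mem T _ u (iP n) uin.
      have [rv _ _] := round_up_mem T _ v (iP n) vin.
      apply: le_trans (_ : _ <= (w (round_up (P n) u) (round_up (P n) v) `^ s^-1) `^ s) _.
        apply: ge0_ler_powR; rewrite ?nnegrE ?powR_ge0// ?(ltW s0)//.
        exact: (area_point n).
      rewrite -powRrM mulVf ?gt_eqF// powRr1//; have [w0 _] := wc; apply: w0 => //.
        by have /andP[] := Tin _ _ ru.
      by have /andP[] := Tin _ _ rv.
    + have T00 : 0 <= (0 : R) <= T by rewrite lexx (ltW T0).
      have TT : 0 <= T <= T by rewrite (ltW T0) lexx.
      rewrite ll; have /andP[h1 h2] := round_upT n _ T00.
      have /andP[h3 h4] := round_upT n _ TT.
      apply: (control_le T) => //; exact: le_trans h3.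
exists w'; split => // x y x0 xy yT; apply: powR_le_root => //; exact: hw'.
Qed.

Let U n t := partition_sum A 0 (clip t (P n)).

Lemma area_sumE n t : 0 <= t <= T -> U n t = (I' t - st n t) - (I' 0 - st n 0).
Proof.
move=> /andP[t0 tT].
have st0 : st n 0 = 0.
  rewrite step_integral_entry// (clip_const _ 0 0)// => x.
  by rewrite subrr mulr0.
rewrite st0 subr0 step_integral_entry// /U.
have -> : A = fun u v => incr I' u v - sa u * (sb v - sb u).
  by apply/funext => u; apply/funext => v; rewrite area_entry.
rewrite /partition_sum sumrB -/(partition_sum (incr I') 0 _).
rewrite partition_sum_telescope last_clip ?lP//.
by rewrite -/(partition_sum (fun u v => sa u * (sb v - sb u)) 0 _); ring.
Qed.

Lemma area_sum_cvg0 e : 0 < e -> \forall n \near \oo,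
  forall t, 0 <= t <= T -> `|U n t| <= e.
Proof.
move=> e0; have e20 : 0 < e / 2 by rewrite divr_gt0.
apply: filterS (step_integral_unif _ e20) => n Hn t tT; rewrite area_sumE//.
have h1 := Hn t tT; have h2 := Hn 0; rewrite lexx (ltW T0) in h2.
by apply: le_trans (ler_normB _ _) _; have := h2 isT; lra.
Qed.

Lemma area_sum_control : exists w', control T w' /\
  forall n u v, u \in 0 :: P n -> v \in 0 :: P n -> u <= v ->
     `|U n v - U n u| <= w' u v `^ (p / 2)^-1.
Proof.
have s0 : 0 < p / 2 by rewrite divr_gt0.
(* The increment of [U n] is the limit area minus the [n]-th area, each at most [w^(2/p)]; the
   factor turns into the [2] of this sum. *)
exists (fun u v => 2 `^ (p / 2) * w u v); split.
  by apply: controlZ => //; exact: powR_ge0.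
move=> n u v uP vP uv; have uT := Tin _ _ uP; have vT := Tin _ _ vP.
have w0 : 0 <= w u v.
  by have [w0 _] := wc; case/andP: uT vT => ? _ /andP[_ ?]; exact: w0.
rewrite powRM ?powR_ge0// -powRrM mulfV ?gt_eqF// powRr1//.
rewrite !area_sumE//.
have -> : I' v - st n v - (I' 0 - st n 0) - (I' u - st n u - (I' 0 - st n 0)) =
  A u v - (st n v - st n u - sa u * (sb v - sb u)) by rewrite area_entry; ring.
apply: le_trans (ler_normB _ _) _; rewrite mulr2n mulrDl mul1r.
by apply: lerD; [exact: (area_point n)|exact: step_area_point].
Qed.

End Area.

(** * The compensated germ *)

Section Germ.
Context {R : realType} {d : nat}.
Context (T p q r : R) (T0 : 0 < T) (p0 : 0 < p) (q0 : 0 < q)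
  (hq : 1 < 2 / p + 1 / q) (hr : 1 / r = 1 / p + 1 / q).
Context (S : 'I_d -> R -> R) (A : 'I_d -> 'I_d -> R -> R -> R).
Context (f g : R -> R) (f' g' : 'I_d -> R -> R).

Definition path_remainder (x : R -> R) (x' : 'I_d -> R -> R) s t :=
  incr x s t - \sum_(a < d) x' a s * incr (S a) s t.

Definition compensated_germ s t :=
  f s * incr g s t + \sum_(a < d) \sum_(b < d) A a b s t * (f' a s * g' b s).

Lemma compensated_germ_refl : (forall a b s, A a b s s = 0) ->
  forall s, compensated_germ s s = 0.
Proof.
move=> A0 s; rewrite /compensated_germ /incr subrr mulr0 add0r big1// => a _.
by rewrite big1// => b _; rewrite A0 mul0r.
Qed.

(** Splitting both increments in [incr f s u * incr g u t] into derivative part and remainder leaves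
    a product of derivative parts, with [f'] taken at [s] and [g'] at [u]. Chen's relation cancels
    it except that there both are taken at [s], whence the term with [incr (g' b) s u]. *)
Lemma compensated_germ_defect s u t :
  (forall a b, A a b s t = A a b s u + A a b u t + incr (S a) s u * incr (S b) u t) ->
  compensated_germ s t - compensated_germ s u - compensated_germ u t =
  - path_remainder f f' s u * incr g u t +
  \sum_(a < d) (- (f' a s * incr (S a) s u) * path_remainder g g' u t +
    \sum_(b < d) (- (f' a s * (incr (S a) s u * incr (g' b) s u)) * incr (S b) u t +
      - incr (fun x => f' a x * g' b x) s u * A a b u t)).
Proof.
move=> chen.
pose X := \sum_(a < d) f' a s * incr (S a) s u.
pose Y := \sum_(b < d) g' b u * incr (S b) u t.
have XY : X * Y = \sum_(a < d) \sum_(b < d)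
    (f' a s * incr (S a) s u * (g' b u * incr (S b) u t)).
  by rewrite /X mulr_suml; apply: eq_bigr => a _; rewrite mulr_sumr.
have fg : path_remainder f f' s u * incr g u t + X * path_remainder g g' u t +
    X * Y = incr f s u * incr g u t by rewrite /path_remainder -/X -/Y; ring.
rewrite big_split /= -mulr_suml sumrN -/X.
have -> : \sum_(a < d) \sum_(b < d)
    (- (f' a s * (incr (S a) s u * incr (g' b) s u)) * incr (S b) u t +
      - incr (fun x => f' a x * g' b x) s u * A a b u t) =
    \sum_(a < d) \sum_(b < d) A a b s t * (f' a s * g' b s) -
    \sum_(a < d) \sum_(b < d) A a b s u * (f' a s * g' b s) -
    \sum_(a < d) \sum_(b < d) A a b u t * (f' a u * g' b u) - X * Y.
  rewrite XY -!sumrB; apply: eq_bigr => a _; rewrite -!sumrB; apply: eq_bigr => b _.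
  by rewrite chen /incr; ring.
rewrite /compensated_germ.
have -> : - path_remainder f f' s u * incr g u t =
  - (incr f s u * incr g u t) + X * path_remainder g g' u t + X * Y.
  by rewrite -fg; ring.
by rewrite /incr; ring.
Qed.

Lemma incr_bounded alpha (h : R -> R) : 0 <= alpha -> holder T alpha (incr h) ->
  exists2 M, 0 < M & forall t, 0 <= t <= T -> `|h t| <= M.
Proof.
move=> a0 /(holder_bounded _ _ _ a0)[M M0 HM]; exists (`|h 0| + M).
  by rewrite ltr_wpDl.
move=> t /andP[t0 tT]; have -> : h t = h 0 + incr h 0 t by rewrite /incr; ring.
by apply: le_trans (ler_normD _ _) _; rewrite lerD2l HM.
Qed.

Context (hS : forall a, holder T p^-1 (incr (S a)))
  (oS : forall a, small_osc T (incr (S a))).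

(** The remainder is an increment of [x] plus increments of [S] with bounded weights, so it inherits
    their exceptional points. *)
Lemma path_remainder_osc x x' : small_osc T (incr x) ->
  (forall a, holder T q^-1 (incr (x' a))) -> small_osc T (path_remainder x x').
Proof.
move=> ox hx'.
have q1 : 0 <= q^-1 by rewrite invr_ge0 ltW.
have H a : small_osc T (fun s t => - x' a s * incr (S a) s t).
  have [M M0 HM] := incr_bounded _ _ q1 (hx' a).
  apply: (small_osc_weight T (fun s _ => - x' a s) _ M); last exact: oS.
  by move=> s t s0 st tT; rewrite normrN HM// s0 (le_trans st).
apply: (small_osc_le _ _ _ (small_oscD _ _ _ ox (small_osc_sum T _ (index_enum _) _ H))).
move=> s t _ _ _; rewrite /path_remainder -sumrN.
by under [X in _ <= `|_ + X|]eq_bigr do rewrite mulNr.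
Qed.

Context (hA : forall a b, holder T (p / 2)^-1 (A a b))
  (oA : forall a b, small_osc T (A a b))
  (chen : forall a b s u t, A a b s t =
     A a b s u + A a b u t + incr (S a) s u * incr (S b) u t)
  (of_ : small_osc T (incr f)) (hg : holder T p^-1 (incr g)) (og : small_osc T (incr g))
  (hf' : forall a, holder T q^-1 (incr (f' a))) (of' : forall a, small_osc T (incr (f' a)))
  (hg' : forall a, holder T q^-1 (incr (g' a))) (og' : forall a, small_osc T (incr (g' a)))
  (hRf : holder T r^-1 (path_remainder f f')) (hRg : holder T r^-1 (path_remainder g g')).

Let p1 : 0 < p^-1. Proof. by rewrite invr_gt0. Qed.
Let q1 : 0 < q^-1. Proof. by rewrite invr_gt0. Qed.

Lemma incr_mul_holder_osc a b :
  holder T q^-1 (incr (fun x => f' a x * g' b x)) /\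
  small_osc T (incr (fun x => f' a x * g' b x)).
Proof.
have [M1 M10 HM1] := incr_bounded _ _ (ltW q1) (hf' a).
have [M2 M20 HM2] := incr_bounded _ _ (ltW q1) (hg' b).
have b1 s t : 0 <= s -> s <= t -> t <= T -> `|f' a s| <= M1.
  by move=> s0 st tT; rewrite HM1// s0 (le_trans st).
have b2 s t : 0 <= s -> s <= t -> t <= T -> `|g' b t| <= M2.
  by move=> s0 st tT; rewrite HM2// tT (le_trans s0).
have E s t : incr (fun x => f' a x * g' b x) s t =
    f' a s * incr (g' b) s t + g' b t * incr (f' a) s t.
  by rewrite /incr; ring.
split.
  apply: (holder_le _ _ _ (fun s t => f' a s * incr (g' b) s t + g' b t * incr (f' a) s t)).
    apply: holderD => //.
      exact: (holder_weight T _ (fun s _ => f' a s) _ M1).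
    exact: (holder_weight T _ (fun _ t => g' b t) _ M2).
  by move=> *; rewrite E.
apply: (small_osc_le _ _ (fun s t => f' a s * incr (g' b) s t + g' b t * incr (f' a) s t)).
  apply: small_oscD.
    exact: (small_osc_weight T (fun s _ => f' a s) _ M1).
  exact: (small_osc_weight T (fun _ t => g' b t) _ M2).
by move=> *; rewrite E.
Qed.

(** The four kinds of products have exponents [1/r + 1/p], [1/p + 1/r], [(1/p + 1/q) + 1/p] and
    [1/q + 2/p], all equal to [2/p + 1/q]. *)
Lemma compensated_germ_small_defect :
  small_defect T ((1 + (2 / p + 1 / q)) / 2)
    (fun s u t => compensated_germ s t - compensated_germ s u - compensated_germ u t).
Proof.
have r1 : 0 < r^-1.
  by move: hr; rewrite !mul1r => ->; rewrite addr_gt0.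
have rE : r^-1 = p^-1 + q^-1 by move: hr; rewrite !mul1r.
have th0 : 0 <= (1 + (2 / p + 1 / q)) / 2.
  by rewrite divr_ge0// addr_ge0// ltW// (lt_trans _ hq).
have p20 : 0 < (p / 2)^-1 by rewrite invr_gt0 divr_gt0.
have mulD X Y alpha beta : 0 < alpha -> 0 < beta -> alpha + beta = 2 / p + 1 / q ->
    holder T alpha X -> holder T beta Y -> small_osc T X -> small_osc T Y ->
    small_defect T ((1 + (2 / p + 1 / q)) / 2) (fun s u t => - X s u * Y u t).
  move=> a0 b0 ab hX hY oX oY.
  apply: (small_defect_le _ _ _ (fun s u t => X s u * Y u t)); last first.
    by move=> *; rewrite mulNr normrN.
  by rewrite -ab; apply: small_defectM => //; rewrite ab.
pose D s u t := - path_remainder f f' s u * incr g u t +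
  \sum_(a < d) (- (f' a s * incr (S a) s u) * path_remainder g g' u t +
    \sum_(b < d) (- (f' a s * (incr (S a) s u * incr (g' b) s u)) * incr (S b) u t +
      - incr (fun x => f' a x * g' b x) s u * A a b u t)).
apply: (small_defect_le _ _ _ D); last first.
  by move=> s u t _ _ _ _; rewrite compensated_germ_defect.
have oRf := path_remainder_osc f f' of_ hf'.
have oRg := path_remainder_osc g g' og hg'.
apply: small_defectD => //.
  by apply: (mulD _ _ r^-1 p^-1) => //; rewrite rE; field; rewrite !gt_eqF.
apply: small_defect_sum => // a.
have [M M0 HM] := incr_bounded _ _ (ltW q1) (hf' a).
have b1 s t : 0 <= s -> s <= t -> t <= T -> `|f' a s| <= M.
  by move=> s0 st tT; rewrite HM// s0 (le_trans st).
apply: small_defectD => //.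
  apply: (mulD (fun s u => f' a s * incr (S a) s u) _ p^-1 r^-1) => //.
  - by rewrite rE; field; rewrite !gt_eqF.
  - exact: (holder_weight T _ (fun s _ => f' a s) _ M).
  - exact: (small_osc_weight T (fun s _ => f' a s) _ M).
apply: small_defect_sum => // b; apply: small_defectD => //.
  apply: (mulD (fun s u => f' a s * (incr (S a) s u * incr (g' b) s u)) _
    (p^-1 + q^-1) p^-1) => //.
  - by rewrite addr_gt0.
  - by field; rewrite !gt_eqF.
  - apply: (holder_weight T _ (fun s _ => f' a s) _ M) => //; first by rewrite addr_gt0.
    exact: holderM.
  - apply: (small_osc_weight T (fun s _ => f' a s) _ M) => //.
    have [N N0 HN] := holder_bounded _ _ _ (ltW p1) (hS a).
    exact: (small_osc_weight T (incr (S a)) _ N).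
have [hfg ofg] := incr_mul_holder_osc a b.
apply: (mulD _ _ q^-1 (p / 2)^-1) => //.
by field; rewrite !gt_eqF.
Qed.

End Germ.

(** * Limits as the mesh tends to zero *)

Section MeshLimit.
Context {R : realType}.

Lemma fine_mesh (delta a : R) s : 0 < delta -> path (fine_step delta) a s ->
  mesh a s < delta.
Proof.
move=> d0; elim: s a => [|b s IH] a; first by rewrite /mesh big_nil.
by rewrite /mesh /= => /andP[/andP[_ h] bs]; rewrite big_cons gt_max /= h; exact: IH.
Qed.

Lemma fine_partition_exists (delta t : R) : 0 < delta -> 0 <= t ->
  exists2 s, itv_partition 0 t s & path (fine_step delta) 0 s.
Proof.
move=> d0 t0; have d20 : 0 < delta / 2 by rewrite divr_gt0.
have [N] : exists N : nat, t <= N%:R * (delta / 2).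
  exists (Num.trunc (t / (delta / 2))).+1.
  rewrite -ler_pdivrMr//; apply/ltW; have := archimedean.Num.Theory.truncnS_gt.
  by apply.
elim: N t t0 => [|N IH] t t0.
  rewrite mul0r => t00; have -> : t = 0 by apply/le_anti; rewrite t0 t00.
  by exists [::]; split.
move=> tN; have [td|dt] := leP t (delta / 2).
  move: t0; rewrite le_eqVlt => /orP[/eqP<-|tp]; first by exists [::]; split.
  exists [:: t]; first exact: itv_partition1.
  by rewrite /= /fine_step (ltW tp) subr0 /= andbT; lra.
have [||s [ps /eqP ls] fs] := IH (t - delta / 2); first by lra.
  by move: tN; rewrite -natr1 mulrDl mul1r; lra.
exists (rcons s t); first by split; rewrite ?last_rcons// rcons_path ps ls ltrBlDr ltrDl.
rewrite rcons_path fs ls /fine_step /=; apply/andP; split; lra.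
Qed.

Lemma mesh_to0_proper (t : R) : 0 <= t -> ProperFilter (mesh_to0 0 t).
Proof.
move=> t0; apply: filter_from_proper; last first.
  move=> e /= e0; have [s sP fs] := fine_partition_exists e t e0 t0.
  by exists s; split => //; exact: fine_mesh.
apply: filter_from_filter; first by exists 1; rewrite /= ltr01.
move=> i j /= i0 j0; exists (Num.min i j); first by rewrite /= lt_min i0.
by move=> s /= [sP]; rewrite lt_min => /andP[h1 h2].
Qed.

Lemma mesh_to0_fine (t delta : R) : 0 < delta -> \forall s \near mesh_to0 0 t,
  path (fine_step delta) 0 s /\ last 0 s = t.
Proof.
move=> d0; exists delta => // s /= [[ps /eqP ls] ms]; split => //.
by apply: mesh_fine => //; apply: sub_path ps => x y /ltW.
Qed.

(** The error bound has one [delta] for all [t] and admits lists with repeated points; both are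
    essential for clipped partitions. *)
Lemma mesh_limit (T : R) (X : R -> R -> R) :
  (forall e, 0 < e -> exists2 delta, 0 < delta &
     forall s s', path (fine_step delta) 0 s -> path (fine_step delta) 0 s' ->
       last 0 s = last 0 s' -> last 0 s <= T ->
       `|partition_sum X 0 s - partition_sum X 0 s'| <= e) ->
  exists L : R -> R,
    (forall t, 0 <= t <= T -> partition_sum X 0 s @[s --> mesh_to0 0 t] --> L t) /\
    forall e, 0 < e -> exists2 delta, 0 < delta &
      forall s t, path (fine_step delta) 0 s -> last 0 s = t -> 0 <= t <= T ->
        `|L t - partition_sum X 0 s| <= e.
Proof.
move=> H; exists (fun t => lim (partition_sum X 0 s @[s --> mesh_to0 0 t])).
have cv t : 0 <= t <= T -> cvg (partition_sum X 0 s @[s --> mesh_to0 0 t]).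
  move=> /andP[t0 tT]; have PF := mesh_to0_proper t t0.
  apply/cauchy_cvgP; apply: cauchy_exP => e e0.
  have e20 : 0 < e / 2 by rewrite divr_gt0.
  have [delta d0 Hd] := H _ e20.
  have [s0 [fs0 ls0]] := filter_ex (mesh_to0_fine t delta d0).
  exists (partition_sum X 0 s0); apply: filterS (mesh_to0_fine t delta d0).
  move=> s [fs ls]; rewrite -ball_normE /=.
  apply: le_lt_trans (Hd _ _ fs0 fs _ _) _; rewrite ?ls0 ?ls//.
  by lra.
split; first exact: cv.
move=> e e0; have e20 : 0 < e / 2 by rewrite divr_gt0.
have [delta d0 Hd] := H _ e20; exists delta => // s t fs ls tT.
have PF : ProperFilter (mesh_to0 0 t) by apply: mesh_to0_proper; case/andP: tT.
have /cvgrPdist_le/(_ _ e20) c := cv t tT.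
(* An intermediate partition with sum close to the limit, and fine enough to be compared with
   [s]. *)
have [s' [[fs' ls'] h]] := filter_ex (filterI (mesh_to0_fine t delta d0) c).
have := Hd s' s fs' fs; rewrite ls' ls => /(_ erefl (proj2 (andP tT))) h2.
set L := lim _ in h *.
have -> : L - partition_sum X 0 s = (L - partition_sum X 0 s') +
  (partition_sum X 0 s' - partition_sum X 0 s) by ring.
by apply: le_trans (ler_normD _ _) _; rewrite (splitr e) lerD.
Qed.

End MeshLimit.

(** * Reduction to scalar germs *)

Lemma partition_sumD {R : realType} {V : zmodType} (f g : R -> R -> V) x s :
  partition_sum (fun u v => f u v + g u v) x s =
  partition_sum f x s + partition_sum g x s.
Proof. exact: big_split. Qed.

Lemma partition_sum_sum {R : realType} {V : zmodType} (I : finType)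
    (f : I -> R -> R -> V) x s :
  partition_sum (fun u v => \sum_i f i u v) x s = \sum_i partition_sum (f i) x s.
Proof. exact: exchange_big. Qed.

Lemma partition_sumZ {R : realType} {V : lmodType R} (f : R -> R -> R) (E : V) x s :
  partition_sum (fun u v => f u v *: E) x s = partition_sum f x s *: E.
Proof. by rewrite /partition_sum scaler_suml. Qed.

Section Bilinear.
Context {R : realType} {d : nat} {V : lmodType R}
  (B : {bilinear 'cV[R]_d -> 'cV[R]_d -> V}).

(** All sums lie in the span of these finitely many vectors, so the Cauchy argument takes place in
    [R] and [V] can be any normed module. *)
Definition bilinear_coef i j : V := B (delta_mx i ord0) (delta_mx j ord0).

Lemma bilinear_expand x y :
  B x y = \sum_i \sum_j (x i ord0 * y j ord0) *: bilinear_coef i j.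
Proof.
have E (z : 'cV[R]_d) : z = \sum_i z i ord0 *: delta_mx i ord0.
  rewrite {1}(matrix_sum_delta z); apply: eq_bigr => i _.
  by rewrite big_ord_recl big_ord0 addr0.
rewrite {1}(E x) {1}(E y) linear_sumlz; apply: eq_bigr => i _.
rewrite linear_sumr; apply: eq_bigr => j _.
by rewrite linearZl_LR linearZr_LR /= scalerA.
Qed.

Lemma compensator_expand (F' G' A : 'M[R]_d) : compensator B F' G' A =
  \sum_i \sum_j (\sum_a \sum_b A a b * (F' i a * G' j b)) *: bilinear_coef i j.
Proof.
rewrite /compensator pair_bigA [RHS]pair_bigA /=.
transitivity (\sum_(ab : 'I_d * 'I_d) \sum_(ij : 'I_d * 'I_d)
  (A ab.1 ab.2 * (F' ij.1 ab.1 * G' ij.2 ab.2)) *: bilinear_coef ij.1 ij.2).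
  apply: eq_bigr => -[a b] _ /=; rewrite bilinear_expand pair_bigA scaler_sumr.
  by apply: eq_bigr => -[i j] _ /=; rewrite !mxE scalerA.
rewrite exchange_big; apply: eq_bigr => -[i j] _ /=.
by rewrite pair_bigA scaler_suml.
Qed.

End Bilinear.

(** [rough_integral] is a [lim], which has a value even where nothing converges; the first conjunct
    certifies that it is a genuine limit. *)
Theorem theorem2p14 (R : realType) (T : R) (d : nat) (V : normedModType R)
    (B : {bilinear 'cV[R]_d -> 'cV[R]_d -> V})
    (p q r : R) (S : R -> 'cV[R]_d) (P : nat -> seq R)
    (F : R -> 'cV[R]_d) (F' : R -> 'M[R]_d)
    (G : R -> 'cV[R]_d) (G' : R -> 'M[R]_d)
    (hT : 0 < T) (hp : 2 < p < 3) (hpq : p <= q) (hq : 1 < 2 / p + 1 / q)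
    (hr : 1 < r) (hrpq : 1 / r = 1 / p + 1 / q)
    (hS : cadlag 0 T S) (hRIE : RIE T p P S)
    (hF : controlled T p q r S F F') (hG : controlled T p q r S G G')
    (hJ : jump_times T F `<=` \bigcup_n [set` 0 :: P n]) :
  (forall t, 0 <= t <= T ->
     cvg (compensated_sum B (area P S) F F' G G' s @[s --> mesh_to0 0 t])) /\
  {uniform [set` `[0, T]],
     left_point_sum B P F G n @[n --> \oo] -->
       rough_integral B (area P S) F F' G G'}.
Proof.
have p0 : 0 < p by move: hp => /andP[? _]; lra.
have q0 : 0 < q by lra.
have r0 : 0 < r by lra.
have T0 := ltW hT.
have [_ hP _ [I hI] [w [wc hb]]] := hRIE.
have pP n : path <=%R 0 (P n).
  by have [iP _ _] := hP; have [+ _] := iP n; apply: sub_path => x y /ltW.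
have lP n : last 0 (P n) = T by have [iP _ _] := hP; have [_ /eqP] := iP n.
pose s' (a : 'I_d) t := S t a ord0.
pose A a b u v := area P S u v a b.
have hs a : holder T p^-1 (incr (s' a)) by exact: RIE_path_holder hb _.
have os a : small_osc T (incr (s' a)).
  by apply: cadlag_small_osc => //; exact: cadlag_entry.
have hA a b : holder T (p / 2)^-1 (A a b) by exact: area_holder hb _ hI _ _.
have oA a b : small_osc T (A a b) by exact: area_osc hb _ hI _ _.
have chen a b s u t : A a b s t =
    A a b s u + A a b u t + incr (s' a) s u * incr (s' b) u t.
  exact: area_chen.
have entry_incr m n (e : R) (X : R -> 'M[R]_(m, n)) i j : 0 < e ->
    Dp T e X -> holder T e^-1 (incr (fun t => X t i j)) /\
    small_osc T (incr (fun t => X t i j)).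
  move=> e0 [cX vX]; split.
    apply: (holder_le _ _ _ _ (pvar_holder T e (incr X) i j hT e0 _ vX)).
      by move=> s; rewrite /incr subrr.
    by move=> s t _ _ _; rewrite /incr !mxE.
  by apply: cadlag_small_osc => //; exact: cadlag_entry.
have rem X X' i : controlled T p q r S X X' ->
    holder T r^-1 (path_remainder s' (fun t => X t i ord0) (fun a t => X' t i a)).
  move=> [_ _ [_ _ vR]].
  apply: (holder_le _ _ _ _ (pvar_holder T r (remainder S X X') i ord0 hT r0 _ vR)).
    by move=> s; rewrite /remainder /incr !subrr mulmx0 subrr.
  move=> s t _ _ _; rewrite /remainder /path_remainder /incr !mxE.
  by under [X in _ <= `|_ - X|]eq_bigr do rewrite !mxE.
have [DF DF' _] := hF; have [DG DG' _] := hG.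
pose f i t := F t i ord0; pose g j t := G t j ord0.
pose f' i a t := F' t i a; pose g' j b t := G' t j b.
pose germ i j := compensated_germ A (f i) (g j) (f' i) (g' j).
pose is_limit i j (L : R -> R) :=
  (forall t, 0 <= t <= T ->
     partition_sum (germ i j) 0 s @[s --> mesh_to0 0 t] --> L t) /\
  forall e, 0 < e -> exists2 delta, 0 < delta &
    forall s t, path (fine_step delta) 0 s -> last 0 s = t -> 0 <= t <= T ->
      `|L t - partition_sum (germ i j) 0 s| <= e.
have ex_limit (ij : 'I_d * 'I_d) : exists L, is_limit ij.1 ij.2 L.
  case: ij => i j; rewrite /is_limit /=.
  apply: mesh_limit; apply: (sewing_cauchy _ _ ((1 + (2 / p + 1 / q)) / 2)) => //.
  - by rewrite ltr_pdivlMr//; lra.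
  - by move=> x _; apply: compensated_germ_refl => a b s; exact: area_refl.
  - apply: (compensated_germ_small_defect T p q r p0 q0 hq hrpq s') => //.
    + by have [] := entry_incr _ _ p F i ord0 p0 DF.
    + by have [] := entry_incr _ _ p G j ord0 p0 DG.
    + by have [] := entry_incr _ _ p G j ord0 p0 DG.
    + by move=> a; have [] := entry_incr _ _ q F' i a q0 DF'.
    + by move=> a; have [] := entry_incr _ _ q F' i a q0 DF'.
    + by move=> a; have [] := entry_incr _ _ q G' j a q0 DG'.
    + by move=> a; have [] := entry_incr _ _ q G' j a q0 DG'.
    + exact: rem.
    + exact: rem.
have /choice[L0 hL0] := ex_limit.
pose L1 i j := L0 (i, j); have hL1 i j : is_limit i j (L1 i j) := hL0 (i, j).
pose E := bilinear_coef B.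
pose L t : V := \sum_i \sum_j L1 i j t *: E i j.
have sumE s : compensated_sum B (area P S) F F' G G' s =
    \sum_i \sum_j partition_sum (germ i j) 0 s *: E i j.
  rewrite /compensated_sum.
  under eq_bigr do under eq_bigr do rewrite -partition_sumZ.
  under eq_bigr do rewrite -partition_sum_sum.
  rewrite -partition_sum_sum; congr partition_sum.
  apply/funext => u; apply/funext => v.
  rewrite bilinear_expand compensator_expand -big_split; apply: eq_bigr => i _ /=.
  rewrite -big_split; apply: eq_bigr => j _ /=; rewrite -scalerDl.
  by rewrite /germ /compensated_germ /incr !mxE.
have Lcvg t : 0 <= t <= T ->
    compensated_sum B (area P S) F F' G G' s @[s --> mesh_to0 0 t] --> L t.
  move=> tT; have PF : ProperFilter (mesh_to0 0 t).
    by apply: mesh_to0_proper; case/andP: tT.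
  under eq_cvg do rewrite sumE.
  apply: cvg_big => [|i _]; first exact: add_continuous.
  apply: cvg_big => [|j _]; first exact: add_continuous.
  by apply: cvgZr_tmp; have [h _] := hL1 i j; exact: h.
split; first by move=> t tT; apply/cvg_ex; exists (L t); exact: Lcvg.
have roughE t : 0 <= t <= T -> rough_integral B (area P S) F F' G G' t = L t.
  move=> tT; have PF : ProperFilter (mesh_to0 0 t).
    by apply: mesh_to0_proper; case/andP: tT.
  by apply: cvg_lim; [exact: norm_hausdorff|exact: Lcvg].
have leftE n t : 0 <= t -> left_point_sum B P F G n t = \sum_i \sum_j
    partition_sum (fun u v => f i u * incr (g j) u v) 0 (clip t (P n)) *: E i j.
  move=> t0; rewrite left_point_sum_clip//; last by move=> x; rewrite linear0r.
  under eq_bigr do under eq_bigr do rewrite -partition_sumZ.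
  under eq_bigr do rewrite -partition_sum_sum.
  rewrite -partition_sum_sum; congr partition_sum.
  apply/funext => u; apply/funext => v; rewrite bilinear_expand.
  by apply: eq_bigr => i _; apply: eq_bigr => j _; rewrite /incr !mxE.
have scalar i j e : 0 < e -> \forall n \near \oo, forall t, 0 <= t <= T ->
    `|L1 i j t - partition_sum (fun u v => f i u * incr (g j) u v) 0 (clip t (P n))| <= e.
  move=> e0; have e20 : 0 < e / 2 by rewrite divr_gt0.
  have [_ /(_ _ e20)[delta d0 Hd]] := hL1 i j.
  (* The tolerance [e / 2] is shared among the [d * d] compensator sums; [+ 1] keeps [K] positive
     when [d = 0]. *)
  pose K := d%:R * d%:R + 1 : R.
  have K0 : 0 < K by rewrite ltr_wpDl// mulr_ge0.
  have eK0 : 0 < e / 2 / K by rewrite divr_gt0.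
  have young : \forall n \near \oo, forall a b t, 0 <= t <= T ->
      `|partition_sum (fun u v => f' i a u * g' j b u * A a b u v) 0 (clip t (P n))|
        <= e / 2 / K.
    apply: filter_forall => a; apply: filter_forall => b.
    have [w' [wc' hw']] := area_sum_control _ _ _ _ _ hT p0 hP wc hb _ hI a b.
    apply: (young_sum_cvg0 T q^-1 (p / 2)^-1 (fun x => f' i a x * g' j b x) (A a b) w') => //.
    - by rewrite invr_gt0.
    - by rewrite invr_gt0 divr_gt0.
    - have -> : q^-1 + (p / 2)^-1 = 2 / p + 1 / q by field; rewrite !gt_eqF.
      exact: hq.
    - have h1 c : holder T q^-1 (incr (f' i c)).
        by have [] := entry_incr _ _ q F' i c q0 DF'.
      have h2 c : holder T q^-1 (incr (g' j c)).
        by have [] := entry_incr _ _ q G' j c q0 DG'.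
      have o1 c : small_osc T (incr (f' i c)).
        by have [] := entry_incr _ _ q F' i c q0 DF'.
      have o2 c : small_osc T (incr (g' j c)).
        by have [] := entry_incr _ _ q G' j c q0 DG'.
      by have [] := incr_mul_holder_osc T q q0 (f' i) (g' j) h1 o1 h2 o2 a b.
    - by move=> x; exact: area_refl.
    - by move=> e' e'0; exact: (area_sum_cvg0 _ _ _ hT hP _ hI).
  have [_ _ /cvgrPdist_lt/(_ _ d0) meshP] := hP.
  apply: filterS2 young meshP => n Hy; rewrite sub0r normrN => mP t tT.
  have /andP[t0 tT'] := tT.
  (* Clipping does not enlarge the steps, so a single [n] works for all [t]. *)
  have fP : path (fine_step delta) 0 (clip t (P n)).
    apply: path_fine_clip => //; apply: mesh_fine => //.
    exact: le_lt_trans (ler_norm _) mP.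
  have lc : last 0 (clip t (P n)) = t by rewrite last_clip ?lP.
  have h1 := Hd _ _ fP lc tT.
  have germE : partition_sum (germ i j) 0 (clip t (P n)) =
      partition_sum (fun u v => f i u * incr (g j) u v) 0 (clip t (P n)) +
      \sum_a \sum_b partition_sum (fun u v => f' i a u * g' j b u * A a b u v)
        0 (clip t (P n)).
    rewrite /germ /compensated_germ partition_sumD; congr (_ + _).
    rewrite partition_sum_sum; apply: eq_bigr => a _.
    rewrite partition_sum_sum; apply: eq_bigr => b _.
    by apply: eq_bigr => uv _; rewrite mulrC.
  rewrite germE in h1; set Y := \sum_a _ in h1; set Z := partition_sum _ _ _ in h1 *.
  have YK : `|Y| <= e / 2.
    apply: le_trans (ler_norm_sum _ _ _) _.
    apply: le_trans (_ : _ <= \sum_(a < d) \sum_(b < d) e / 2 / K) _.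
      apply: ler_sum => a _; apply: le_trans (ler_norm_sum _ _ _) _.
      by apply: ler_sum => b _; exact: Hy.
    rewrite !sumr_const !card_ord -mulrnA -[leLHS]mulr_natr natrM mulrAC ler_pdivrMr//.
    by rewrite ler_pM2l// /K lerDl.
  have -> : L1 i j t - Z = (L1 i j t - (Z + Y)) + Y by ring.
  by apply: le_trans (ler_normD _ _) _; rewrite (splitr e) lerD.
apply/uniform_cvgP => e e0.
(* Total size of the coefficients: scalar errors of [e / 2 / K] add up to at most [e / 2] in [V]. *)
pose K := \sum_i \sum_j `|E i j| + 1.
have K0 : 0 < K.
  by rewrite ltr_wpDl//; apply: sumr_ge0 => *; apply: sumr_ge0.
have eK0 : 0 < e / 2 / K by rewrite !divr_gt0.
have : \forall n \near \oo, forall i j t, 0 <= t <= T ->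
    `|L1 i j t - partition_sum (fun u v => f i u * incr (g j) u v) 0 (clip t (P n))|
      <= e / 2 / K.
  by apply: filter_forall => i; apply: filter_forall => j; exact: scalar.
apply: filterS => n Hn t; rewrite /= in_itv /= => tT.
have /andP[t0 _] := tT.
rewrite roughE// leftE// /L -sumrB.
apply: le_lt_trans (_ : e / 2 < e); last by lra.
apply: le_trans (ler_norm_sum _ _ _) _.
apply: le_trans (_ : _ <= \sum_i \sum_j e / 2 / K * `|E i j|) _.
  apply: ler_sum => i _; rewrite -sumrB; apply: le_trans (ler_norm_sum _ _ _) _.
  apply: ler_sum => j _; rewrite -scalerBl normrZ ler_wpM2r//.
  exact: Hn.
under eq_bigr do rewrite -mulr_sumr.
rewrite -mulr_sumr mulrAC ler_pdivrMr// ler_pM2l ?divr_gt0//.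
by rewrite /K lerDl.
Qed.
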